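(* Let $\alpha$ and $\beta$ be two arbitrary positive coprime integers. Then $$\sum_{Y\in\mathcal{Y}}q^{\sharp\{s\in Y\mid \alpha l_Y(s)=\beta(a_Y(s)+1)\}}t^{|Y|}=\prod_{\substack{i\ge 1\\(\alpha+\beta)\nmid i}}\frac{1}{1-t^i}\prod_{i\ge 1}\frac{1}{1-qt^{(\alpha+\beta)i}}.$$
   Context: $\mathcal{Y}$ is the set of all Young diagrams (including the empty one). A Young diagram is regarded as a finite subset $Y\subset\mathbb{Z}_{\ge 0}^2$ such that if $(i,j)\in Y$, $0\le i'\le i$ and $0\le j'\le j$, then $(i',j')\in Y$. $|Y|$ is the number of boxes (elements) of $Y$. Put $r_l(Y)=|\{(i,j)\in Y\mid j=l\}|$ and $c_l(Y)=|\{(i,j)\in Y\mid i=l\}|$. For $s=(i,j)\in\mathbb{Z}_{\ge 0}^2$ put $l_Y(s)=r_j(Y)-i-1$ and $a_Y(s)=c_i(Y)-j-1$. *)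

(* Defs.v *)
From HB Require Import structures.
From mathcomp Require Import all_boot all_order all_algebra.
From mathcomp Require Import finmap.
From mathcomp Require Import boolp classical_sets.

Set Implicit Arguments.
Unset Strict Implicit.
Unset Printing Implicit Defensive.

Import GRing.Theory.

Local Open Scope ring_scope.

(** * Formal power series *)

Record fps (R : Type) := FPS { fps_coef :> nat -> R }.

HB.instance Definition _ (R : Type) := gen_eqMixin (fps R).
HB.instance Definition _ (R : Type) := gen_choiceMixin (fps R).

Lemma fpsP (R : Type) (f g : fps R) : (forall n, f n = g n) -> f = g.
Proof. by case: f g => [f] [g] /= fg; congr FPS; apply/funext. Qed.

Section FpsZmodule.
Variable R : zmodType.
Implicit Types f g : fps R.

Definition fps_zero : fps R := FPS (fun=> 0).
Definition fps_opp f : fps R := FPS (fun n => - f n).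
Definition fps_add f g : fps R := FPS (fun n => f n + g n).

Fact fps_addA : associative fps_add.
Proof. by move=> f g h; apply: fpsP => n /=; rewrite addrA. Qed.
Fact fps_addC : commutative fps_add.
Proof. by move=> f g; apply: fpsP => n /=; rewrite addrC. Qed.
Fact fps_add0 : left_id fps_zero fps_add.
Proof. by move=> f; apply: fpsP => n /=; rewrite add0r. Qed.
Fact fps_addN : left_inverse fps_zero fps_opp fps_add.
Proof. by move=> f; apply: fpsP => n /=; rewrite addNr. Qed.

HB.instance Definition _ :=
  GRing.isZmodule.Build (fps R) fps_addA fps_addC fps_add0 fps_addN.

Lemma fps_coef0 n : (0 : fps R) n = 0. Proof. by []. Qed.
Lemma fps_coefD f g n : (f + g) n = f n + g n. Proof. by []. Qed.
Lemma fps_coefN f n : (- f) n = - f n. Proof. by []. Qed.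

End FpsZmodule.

Section FpsRing.
Variable R : comNzRingType.
Implicit Types (c : R) (f g : fps R).

Definition fpsC c : fps R := FPS (fun n => if n is 0%N then c else 0).
Definition fpsX : fps R := FPS (fun n => (n == 1%N)%:R).
Definition fps_mul f g : fps R := FPS (fun n => \sum_(i < n.+1) f i * g (n - i)%N).

Let trunc N f : {poly R} := \poly_(i < N) f i.

Let trunc_mul N f g n : (n < N)%N -> (trunc N f * trunc N g)`_n = fps_mul f g n.
Proof.
move=> nN; rewrite coefM; apply: eq_bigr => -[i /= le_in] _.
by rewrite !coef_poly (leq_trans le_in nN) (leq_ltn_trans (leq_subr _ _) nN).
Qed.

Fact fps_mulC : commutative fps_mul.
Proof.
by move=> f g; apply: fpsP => n; rewrite -!(trunc_mul _ _ (ltnSn n)) mulrC.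
Qed.

Fact fps_mulA : associative fps_mul.
Proof.
move=> f g h; apply: fpsP => n; set P := trunc n.+1.
transitivity ((P f * (P g * P h))`_n).
  rewrite coefM; apply: eq_bigr => -[i /= le_in] _.
  by rewrite coef_poly le_in (@trunc_mul n.+1) // ltnS leq_subr.
rewrite mulrA coefM; apply: eq_bigr => -[i /= le_in] _.
by rewrite (@trunc_mul n.+1) // coef_poly ltnS leq_subr.
Qed.

Fact fps_mul1 : left_id (fpsC 1) fps_mul.
Proof.
move=> f; apply: fpsP => n /=.
by rewrite big_ord_recl /= mul1r subn0 big1 ?addr0 // => i _; rewrite mul0r.
Qed.

Fact fps_mulDl : left_distributive fps_mul +%R.
Proof.
move=> f g h; apply: fpsP => n /=.
by rewrite -big_split; apply: eq_bigr => i _; rewrite /= mulrDl.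
Qed.

Fact fps_oner_neq0 : fpsC 1 != 0.
Proof.
apply/eqP => /(congr1 (fun f : fps R => f 0%N)) /eqP.
by rewrite /= oner_eq0.
Qed.

HB.instance Definition _ := GRing.Zmodule_isComNzRing.Build (fps R)
  fps_mulA fps_mulC fps_mul1 fps_mulDl fps_oner_neq0.

Lemma fps_coef1 n : (1 : fps R) n = (n == 0%N)%:R. Proof. by case: n. Qed.
Lemma fps_coefM f g n : (f * g) n = \sum_(i < n.+1) f i * g (n - i)%N.
Proof. by []. Qed.

End FpsRing.

Section FpsUnitRing.
Variable R : comUnitRingType.
Implicit Types f g : fps R.

Definition fps_unit : {pred fps R} := fun f => f 0%N \is a GRing.unit.

(* The first n.+1 coefficients of the inverse of f, obtained by solving
   (f * g) n = 0 for g n, successively for n = 1, 2, ... *)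
Fixpoint fps_inv_coefs f n : seq R :=
  if n is m.+1 then
    let s := fps_inv_coefs f m in
    rcons s (- (f 0%N)^-1 * \sum_(i < m.+1) f i.+1 * s`_(m - i))
  else [:: (f 0%N)^-1].

(* As for all unit rings of the library, a non-unit is its own inverse. *)
Definition fps_inv f : fps R :=
  if f \in fps_unit then FPS (fun n => (fps_inv_coefs f n)`_n) else f.

Let size_inv_coefs f n : size (fps_inv_coefs f n) = n.+1.
Proof. by elim: n => //= n IHn; rewrite size_rcons IHn. Qed.

Let nth_inv_coefs f n i :
  (i <= n)%N -> (fps_inv_coefs f n)`_i = (fps_inv_coefs f i)`_i.
Proof.
elim: n => [|n IHn]; first by rewrite leqn0 => /eqP->.
rewrite leq_eqVlt => /predU1P[-> //|lt_in].
by rewrite /= nth_rcons size_inv_coefs lt_in IHn.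
Qed.

Fact fps_mulVf : {in fps_unit, left_inverse 1 fps_inv *%R}.
Proof.
move=> f Uf; rewrite mulrC; apply: fpsP => n; rewrite fps_coefM fps_coef1.
rewrite /fps_inv Uf /=; case: n => [|n].
  by rewrite big_ord_recl big_ord0 addr0 /= divrr.
rewrite big_ord_recl /= nth_rcons size_inv_coefs ltnn eqxx mulrA mulrN divrr //.
rewrite mulN1r; apply/eqP; rewrite addrC subr_eq0; apply/eqP.
by apply: eq_bigr => i _; rewrite subSS [in RHS]nth_inv_coefs ?leq_subr.
Qed.

Fact fps_unitPl f g : g * f = 1 -> fps_unit f.
Proof.
move=> /(congr1 (fun h : fps R => h 0%N)).
rewrite fps_coefM big_ord_recl big_ord0 addr0 /= => gf1.
by apply/unitrPr; exists (g 0%N); rewrite mulrC.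
Qed.

Fact fps_inv_out : {in [predC fps_unit], fps_inv =1 id}.
Proof. by move=> f /negbTE nUf; rewrite /fps_inv nUf. Qed.

HB.instance Definition _ := GRing.ComNzRing_hasMulInverse.Build (fps R)
  fps_mulVf fps_unitPl fps_inv_out.

Lemma fps_unitE f : (f \is a GRing.unit) = (f 0%N \is a GRing.unit).
Proof. by []. Qed.

End FpsUnitRing.

(** * Infinite sums and products

  Unconditional convergence over the index set [D], along the finite subsets of
  [D] ordered by inclusion, for the coefficientwise topology on [fps R] with [R]
  discrete: each coefficient is eventually constant. *)

Section Infinite.
Variables (R : comNzRingType) (I : choiceType).
Implicit Types (D : set I) (F : I -> fps R) (S : fps R).

Definition fps_lim D (u : {fset I} -> fps R) S : Prop :=
  forall n, exists2 A0 : {fset I}, (forall i, i \in A0 -> D i) &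
    forall A : {fset I}, (forall i, i \in A -> D i) -> (A0 `<=` A)%fset ->
      u A n = S n.

Definition has_fps_sum D F S : Prop :=
  fps_lim D (fun A => \sum_(i <- A) F i) S.

Definition has_fps_prod D F S : Prop :=
  fps_lim D (fun A => \prod_(i <- A) F i) S.

Lemma fps_lim_unique D u S S' : fps_lim D u S -> fps_lim D u S' -> S = S'.
Proof.
move=> uS uS'; apply: fpsP => n.
have [A AD uA] := uS n; have [B BD uB] := uS' n.
have ABD i : i \in (A `|` B)%fset -> D i by rewrite inE => /orP[/AD|/BD].
by rewrite -(uA (A `|` B)%fset) ?fsubsetUl // (uB (A `|` B)%fset) ?fsubsetUr.
Qed.

End Infinite.

(** * Young diagrams *)

Definition is_young (Y : {fset nat * nat}) : Prop :=
  forall i j i' j' : nat,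
    (i, j) \in Y -> (i' <= i)%N -> (j' <= j)%N -> (i', j') \in Y.

Definition young : set {fset nat * nat} := [set Y | is_young Y]%classic.

Section ArmLeg.
Variable Y : {fset nat * nat}.

Definition row_len (l : nat) : nat := #|` [fset s in Y | s.2 == l]%fset|.
Definition col_len (l : nat) : nat := #|` [fset s in Y | s.1 == l]%fset|.

Definition leg (s : nat * nat) : int := (row_len s.2)%:Z - s.1%:Z - 1.
Definition arm (s : nat * nat) : int := (col_len s.1)%:Z - s.2%:Z - 1.

Definition nb_special (alpha beta : nat) : nat :=
  #|` [fset s in Y | alpha%:Z * leg s == beta%:Z * (arm s + 1)]%fset|.

End ArmLeg.

(** * The ring Z[q][[t]] *)

Definition Zqt : comUnitRingType := fps {poly int}.
Definition q : Zqt := fpsC 'X.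
Definition t : Zqt := fpsX {poly int}.

(* Main.v *)
(* Follow the boundary of a diagram, with horizontal steps [true] and vertical
   steps [false]: its cells are the pairs of a letter true and a later letter
   false.  Put n = alpha + beta.  By coprimality the special cells are the cells
   whose hook length is divisible by n and whose arm a and leg l satisfy
   a / (l + 1) < x <= (a + 1) / l for x = alpha / beta, and the distribution of
   the number of the latter on the diagrams of size N does not depend on x > 0.
   For x small enough one counts the cells with a = 0 and n | l + 1, where the
   generating function factors over the column heights.

   To cross a wall x = k / Q, send the boundary path to the group Z x Z/n, with
   steps (k, 1) and (-Q, 1), and group the paths by the multiset of their edges
   there.  On a group, the area and the number of cells with
   a / (l + 1) < x < (a + 1) / l are constant.  The other cells counted just
   below x are the inversions at the vertices in the order of arrival, those
   counted just above x the inversions in the order of departure.  Both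
   statistics have the same distribution on a group: following a path through
   arbitrary departure words, up to its end, writes a product of q-binomial
   coefficients as a sum over paths and circulations; the reversed paths give
   the same product, and one concludes by induction on the number of edges. *)
Require Import Defs.
From mathcomp Require Import all_boot all_order all_algebra.
From mathcomp Require Import finmap.
From mathcomp Require Import boolp classical_sets.
From mathcomp Require Import zify ring lra.

Set Implicit Arguments.
Unset Strict Implicit.
Unset Printing Implicit Defensive.

Import Order.TTheory GRing.Theory Num.Theory.

Local Open Scope ring_scope.

(** * Words *)

Fixpoint words N : seq (seq bool) :=
  if N is N'.+1 then
    [::] :: [seq true :: w | w <- words N'] ++ [seq false :: w | w <- words N']
  else [:: [::]].

Lemma mem_words N w : (w \in words N) = (size w <= N)%N.
Proof.
elim: N w => [|N IHN] [|b w] //=; rewrite inE mem_cat /=.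
case: b; apply/orP/idP => [[/mapP|/mapP]|wN].
- by case=> w' + [->]; rewrite IHN.
- by case=> w' _ [].
- by left; rewrite map_f // IHN.
- by case=> w' _ [].
- by case=> w' + [->]; rewrite IHN.
- by right; rewrite map_f // IHN.
Qed.

Lemma words_uniq N : uniq (words N).
Proof.
elim: N => //= N IHN; apply/andP; split.
  by rewrite mem_cat negb_or; apply/andP; split; apply/negP => /mapP[].
have inj b : injective (cons b : seq bool -> _) by move=> ? ? [].
rewrite cat_uniq !map_inj_uniq // IHN /= andbT.
by apply/hasPn => _ /mapP[w _ ->]; apply/negP => /mapP[].
Qed.

(* A pair of a letter true and a later letter false is weighted by F X Y, where
   X and Y count the letters true and false from the former (included) to the
   latter (excluded). *)
Fixpoint ksum (F : nat -> nat -> nat) X Y w : nat :=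
  match w with
  | [::] => 0
  | true :: w' => ksum F X.+1 Y w'
  | false :: w' => F X Y + ksum F X Y.+1 w'
  end%N.

Fixpoint psum F w : nat :=
  if w is b :: w' then ((if b then ksum F 1 0 w' else 0) + psum F w')%N else 0%N.

Lemma eq_ksum F F' X Y w :
  (forall i j, (X <= i <= X + count_mem true w)%N -> F i j = F' i j) ->
  ksum F X Y w = ksum F' X Y w.
Proof.
elim: w X Y => [|[] w IHw] X Y //= FF'.
  by apply: IHw => i j; rewrite addSnnS => /andP[/ltnW Xi iX]; apply: FF'; rewrite Xi.
by rewrite FF' ?leqnn ?leq_addr //; congr addn; apply: IHw.
Qed.

Lemma eq_psum F F' w :
  (forall i j, (0 < i <= count_mem true w)%N -> F i j = F' i j) ->
  psum F w = psum F' w.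
Proof.
elim: w => [|[] w IHw] //= FF'.
congr addn; [apply: eq_ksum => i j ij | apply: IHw => i j ij]; apply: FF' => //.
by case/andP: ij => -> /leqW.
Qed.

(** The mirror of [ksum]: a letter false is supposed to follow [w], after X more letters true and Y
    more letters false, and is paired with each letter true of [w]. *)
Fixpoint esum (F : nat -> nat -> nat) X Y w : nat :=
  if w is b :: w' then
    ((if b then F (X + count_mem true w').+1 (Y + count_mem false w') else 0)
      + esum F X Y w')%N
  else 0%N.

Lemma esum_rcons F X Y w b : esum F X Y (rcons w b) =
  if b then (F X.+1 Y + esum F X.+1 Y w)%N else esum F X Y.+1 w.
Proof.
elim: w => [|a w IHw] /=; first by rewrite !addn0; case: b.
rewrite {}IHw -cats1 !count_cat /=; case: b; case: a => /=;
  by rewrite ?addn0 ?addn1 ?addSn ?addnS ?add0n // addnCA.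
Qed.

Lemma ksum_rcons F X Y w b : ksum F X Y (rcons w b) =
  (ksum F X Y w +
   if b then 0 else F (X + count_mem true w) (Y + count_mem false w))%N.
Proof.
elim: w X Y => [|a w IHw] X Y /=; first by rewrite !addn0; case: b; rewrite ?addn0.
case: a; rewrite {}IHw /=; case: b; rewrite ?addn0 ?add0n ?addn1 ?add1n ?addSnnS ?addnA //.
Qed.

Lemma psum_rcons F w b : psum F (rcons w b) =
  (psum F w + if b then 0 else esum F 0 0 w)%N.
Proof.
elim: w => [|a w IHw] /=; first by case: b.
rewrite {}IHw; case: a; rewrite /= ?ksum_rcons; case: b; rewrite ?addn0 ?add0n //.
by rewrite addnACA.
Qed.

(* Reversing a path exchanges its horizontal and vertical steps. *)
Definition revneg (w : seq bool) := rev (map negb w).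

Lemma revneg_cons b w : revneg (b :: w) = rcons (revneg w) (~~ b).
Proof. by rewrite /revneg /= rev_cons. Qed.

Lemma revnegK : involutive revneg.
Proof. by move=> w; rewrite /revneg map_rev revK -map_comp map_id_in // => b _ /=; rewrite negbK. Qed.

Lemma size_revneg w : size (revneg w) = size w.
Proof. by rewrite size_rev size_map. Qed.

Lemma big_words_revneg (R : nmodType) N (P : pred (seq bool)) (F : seq bool -> R) :
  \sum_(w <- words N | P w) F w =
  \sum_(w <- words N | P (revneg w)) F (revneg w).
Proof.
rewrite -(big_map revneg P F); apply: perm_big; apply: uniq_perm => [||w].
- exact: words_uniq.
- by rewrite map_inj_uniq ?words_uniq //; apply: inv_inj revnegK.
by rewrite mem_words -[w in RHS]revnegK (mem_map (inv_inj revnegK)) mem_words size_revneg.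
Qed.

Lemma esum_revneg F X Y w :
  esum F Y X (revneg w) = ksum (fun i j => F j.+1 i.-1) X.+1 Y w.
Proof.
elim: w X Y => //= b w IHw X Y; rewrite revneg_cons esum_rcons.
by case: b => /=; rewrite IHw.
Qed.

(** A pair stays a pair, its counts X and Y becoming Y + 1 and X - 1: arm and leg are exchanged, as
    in the conjugate diagram. *)
Lemma psum_revneg F w : psum F (revneg w) = psum (fun i j => F j.+1 i.-1) w.
Proof.
elim: w => //= b w IHw; rewrite revneg_cons psum_rcons IHw.
by case: b; rewrite /= ?addn0 ?esum_revneg // addnC.
Qed.

(** * Gaussian binomial coefficients *)

Fixpoint qfact n : {poly int} :=
  if n is m.+1 then qfact m * \sum_(i < m.+1) 'X^i else 1.

(* [qbin k m] enumerates the words with k letters true and m letters false by the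
   number of pairs of a letter true and a later letter false. *)
Fixpoint qbin k m : {poly int} :=
  let fix aux (m : nat) : {poly int} :=
    match k, m with
    | k'.+1, m'.+1 => 'X^m * qbin k' m + aux m'
    | _, _ => 1
    end in aux m.

Lemma qbin0n m : qbin 0 m = 1. Proof. by case: m. Qed.
Lemma qbinn0 k : qbin k 0 = 1. Proof. by case: k. Qed.
Lemma qbinSS k m : qbin k.+1 m.+1 = 'X^(m.+1) * qbin k m.+1 + qbin k.+1 m.
Proof. by []. Qed.

Lemma qbin_pascal k m : (0 < k + m)%N ->
  qbin k m = (if (0 < k)%N then 'X^m * qbin k.-1 m else 0)
             + (if (0 < m)%N then qbin k m.-1 else 0).
Proof.
case: k m => [|k] [|m] // _; rewrite ?qbin0n ?qbinn0 ?qbinSS /= ?add0r //.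
by case: k => [|k]; rewrite expr0 mul1r addr0.
Qed.

Lemma qfact_neq0 n : qfact n != 0.
Proof.
elim: n => [|n IHn]; first exact: oner_neq0.
rewrite /= mulf_neq0 //; apply/eqP => /(congr1 (fun p : {poly int} => p.[1])).
rewrite horner_sum horner0 => /eqP; rewrite (eq_bigr (fun _ => 1)) => [|i _].
  by rewrite sumr_const card_ord pnatr_eq0.
by rewrite hornerXn expr1n.
Qed.

(** The induction splits [k + m + 2] as [m + 1] + X^(m+1) [k + 1], where [j] is the sum of the first
    j powers of X. *)
Lemma qbin_fact k m : qbin k m * (qfact k * qfact m) = qfact (k + m).
Proof.
elim: k m => [|k IHk] m; first by rewrite qbin0n !mul1r add0n.
elim: m => [|m IHm]; first by rewrite qbinn0 addn0 mul1r mulr1.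
rewrite qbinSS mulrDl.
have -> : qbin k.+1 m * (qfact k.+1 * qfact m.+1)
          = qfact (k.+1 + m) * \sum_(i < m.+1) 'X^i by rewrite -IHm /=; ring.
have -> : 'X^(m.+1) * qbin k m.+1 * (qfact k.+1 * qfact m.+1)
          = qfact (k + m.+1) * ('X^(m.+1) * \sum_(i < k.+1) 'X^i).
  by rewrite -IHk /=; ring.
have qfactS n : qfact n.+1 = qfact n * \sum_(i < n.+1) 'X^i by [].
rewrite addSnnS -mulrDr [in RHS]addSn qfactS; congr (_ * _).
rewrite -!(big_mkord xpredT (fun i => 'X^i : {poly int})).
rewrite [RHS](big_cat_nat (n := m.+1)) /=; [|by []|by lia].
rewrite addrC; congr +%R; rewrite -{2}[m.+1]add0n big_addn mulr_sumr.
have -> : ((k + m.+1).+1 - m.+1 = k.+1)%N by lia.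
by apply: eq_bigr => i _; rewrite -exprD addnC.
Qed.

(** * Paths in an abelian group *)

Section Walk.
Variables (V : zmodType) (e s : V).
Implicit Types (u v a b : V) (w : seq bool) (c : V * bool -> nat).

Definition stp (x : bool) : V := if x then e else s.

Fixpoint trace u w : seq (V * bool) :=
  if w is x :: w' then (u, x) :: trace (u + stp x) w' else [::].

Fixpoint endp u w : V := if w is x :: w' then endp (u + stp x) w' else u.

Definition sub1 c y : V * bool -> nat := fun z => (c z - (z == y))%N.

Definition rest u w c : V * bool -> nat :=
  fun y => (c y - count_mem y (trace u w))%N.

Fixpoint fits u w c : bool :=
  if w is x :: w' then (0 < c (u, x))%N && fits (u + stp x) w' (sub1 c (u, x))
  else true.

(** [G] is applied to the displacement between the departure vertices of the two letters: 0 means a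
    common departure vertex, e - s a common arrival vertex. *)
Definition vsum (G : V -> nat) w : nat := psum (fun X Y => G (e *+ X + s *+ Y)) w.

(* If c counts the letters of the departure words, each letter true read along w
   contributes the letters false that its vertex still has to read, later in w or
   never. *)
Fixpoint expo u w c : nat :=
  if w is x :: w' then
    ((if x then c (u, false) else 0) + expo (u + stp x) w' (sub1 c (u, x)))%N
  else 0%N.

(** Conservation of flow, with one unit entering at [a] and leaving at [b]. *)
Definition balanced a b c : Prop := forall v,
  (c (v, true) + c (v, false) + (v == b) =
   c ((v - e)%R, true) + c ((v - s)%R, false) + (v == a))%N.

(** Enumerates by inversions the choices of one departure word per vertex. *)
Definition mass (vs : seq V) c : {poly int} :=
  \prod_(v <- vs) qbin (c (v, true)) (c (v, false)).

Lemma endp_cat u w1 w2 : endp u (w1 ++ w2) = endp (endp u w1) w2.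
Proof. by elim: w1 u => /=. Qed.

Lemma trace_cat u w1 w2 : trace u (w1 ++ w2) = trace u w1 ++ trace (endp u w1) w2.
Proof. by elim: w1 u => //= x w1 IHw u; rewrite IHw. Qed.

Lemma endpE u w : endp u w = u + e *+ count_mem true w + s *+ count_mem false w.
Proof.
elim: w u => [|x w IHw] u; first by rewrite /= !mulr0n !addr0.
rewrite [LHS]IHw /= !mulrnDr !addrA; congr (_ + _).
by case: x; rewrite mulr1n mulr0n addr0 // addrAC.
Qed.

Lemma size_trace u w : size (trace u w) = size w.
Proof. by elim: w u => //= x w IHw u; rewrite IHw. Qed.

Lemma fitsP u w c :
  reflect (forall y, (count_mem y (trace u w) <= c y)%N) (fits u w c).
Proof.
elim: w u c => [|x w IHw] u c /=; first by apply: ReflectT.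
apply: (iffP andP) => [[c_gt0 /IHw le_c] y|le_c].
  have := le_c y; rewrite /sub1 [_ == y]eq_sym.
  by case: eqVneq => [->|_] /=; lia.
split; first by have := le_c (u, x); rewrite eqxx; lia.
apply/IHw => y; have := le_c y; rewrite /sub1 [_ == y]eq_sym.
by move=> /(leq_sub2r (y == (u, x))); rewrite addKn.
Qed.

Lemma rest_cons u x w c :
  rest u (x :: w) c = rest (u + stp x) w (sub1 c (u, x)).
Proof. by apply/funext => y; rewrite /rest /sub1 /= [_ == y]eq_sym subnDA. Qed.

Lemma ksum_trace (G : V -> nat) u v w X Y : v = u + e *+ X + s *+ Y ->
  ksum (fun i j => G (e *+ i + s *+ j)) X Y w =
  (\sum_(y <- trace v w | ~~ y.2) G (y.1 - u)%R)%N.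
Proof.
elim: w v X Y => [|x w IHw] v X Y vE /=; first by rewrite big_nil.
rewrite big_cons; case: x => /=.
  by apply: IHw; rewrite vE mulrSr; rewrite -!addrA [e + _]addrC !addrA.
congr addn; first by rewrite vE -(addrA u) addrAC subrr add0r.
by apply: IHw; rewrite vE mulrSr !addrA.
Qed.

Lemma vsum_cons (G : V -> nat) u x w :
  vsum G (x :: w) =
  ((if x then \sum_(y <- trace (u + e)%R w | ~~ y.2) G (y.1 - u)%R else 0)
   + vsum G w)%N.
Proof. by case: x => //=; rewrite /vsum /= (@ksum_trace G u (u + e)) // addr0. Qed.

Lemma count_sum (T : eqType) (P : pred T) (r : seq T) (y : T) :
  P y -> count_mem y r = (\sum_(z <- r | P z) (z == y))%N.
Proof.
move=> Py; rewrite -sum1_count [LHS]big_mkcond [RHS]big_mkcond; apply: eq_bigr => z _.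
by rewrite /=; case: eqVneq => [->|]; rewrite ?Py //; case: (P z).
Qed.

Lemma expoE u w c : fits u w c ->
  expo u w c = (vsum (fun g => g == 0%R) w + \sum_(y <- trace u w | y.2) rest u w c (y.1, false))%N.
Proof.
elim: w u c => [|x w IHw] u c; first by rewrite big_nil.
move=> fw; have /fitsP/(_ (u, false)) := fw.
case/andP: fw => _ /IHw{}IHw.
rewrite (vsum_cons _ u) rest_cons [expo _ _ _]/= {}IHw.
rewrite big_cons; case: x => /= le_c; last by rewrite !add0n.
have -> : (\sum_(y <- trace (u + e) w | ~~ y.2) ((y.1 - u)%R == 0%R)
           = count_mem (u, false) (trace (u + e)%R w))%N.
  rewrite (@count_sum _ (fun y => ~~ y.2)) //; apply: eq_bigr => -[v []] //= _.
  by rewrite subr_eq0 xpair_eqE andbT.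
by rewrite addnACA /rest /sub1 [(u, false) == _]xpair_eqE andbF subn0 subnKC //
   (leq_trans _ le_c) ?leq_addl.
Qed.

Lemma balanced_sub1 a b c x : (0 < c (a, x))%N ->
  balanced a b c -> balanced (a + stp x) b (sub1 c (a, x)).
Proof.
move=> c_gt0 bal v; have := bal v; rewrite /sub1 !xpair_eqE.
have -> : (v == a + stp x) = (v - stp x == a) by rewrite subr_eq.
have pos (y : V) : ((y == a) <= c (y, x))%N by case: eqP => // ->.
case: x c_gt0 pos => _ pos; rewrite /stp /= ?andbT ?andbF ?subn0.
  have := pos v; have := pos (v - e).
  by set A := v == a; set B := v - e == a; lia.
have := pos v; have := pos (v - s).
by set A := v == a; set B := v - s == a; lia.
Qed.

Lemma mass_sub1 vs c v : uniq vs -> v \in vs -> (0 < c (v, true) + c (v, false))%N ->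
  mass vs c = (if (0 < c (v, true))%N
               then 'X^(c (v, false)) * mass vs (sub1 c (v, true)) else 0)
              + (if (0 < c (v, false))%N then mass vs (sub1 c (v, false)) else 0).
Proof.
move=> Uvs v_vs c_gt0; rewrite /mass (bigD1_seq v) //= qbin_pascal //.
have E x : \prod_(i <- vs | i != v)
    qbin (sub1 c (v, x) (i, true)) (sub1 c (v, x) (i, false)) =
    \prod_(i <- vs | i != v) qbin (c (i, true)) (c (i, false)).
  by apply: eq_bigr => i /negPf iv; rewrite /sub1 !xpair_eqE iv !subn0.
rewrite 2?(bigD1_seq v (r := vs)) //= !E /sub1 !xpair_eqE eqxx /= !subn1 !subn0.
by rewrite mulrDl; case: ifP => _; case: ifP => _; rewrite ?mul0r ?mulrA.
Qed.

(* The path from a that reads the departure words gets stuck only at b; the first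
   step is q-Pascal's rule at a. *)
Lemma mass_expand vs N a b c : uniq vs ->
  (forall v x, (0 < c (v, x))%N -> v \in vs) ->
  (forall x, c (b, x) = 0%N) -> balanced a b c ->
  (\sum_(v <- vs) (c (v, true) + c (v, false)) <= N)%N ->
  mass vs c = \sum_(w <- words N | (endp a w == b) && fits a w c)
                'X^(expo a w c) * mass vs (rest a w c).
Proof.
move=> Uvs; elim: N a c => [|N IHN] a c c_vs cb bal cN.
  have [->|ab] := eqVneq a b.
    rewrite /= big_cons big_nil /= eqxx /= expr0 mul1r addr0; congr mass.
    by apply/funext => y; rewrite /rest subn0.
  have := bal a; rewrite eqxx (negPf ab) => bal_a.
  have c_gt0 : (0 < c (a, true) + c (a, false))%N by lia.
  have a_vs : a \in vs.
    by move: c_gt0; rewrite addn_gt0 => /orP[]; apply: c_vs.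
  by move: cN; rewrite (bigD1_seq a) //=; lia.
have step x w : endp a (x :: w) = endp (a + stp x) w by [].
rewrite /= big_cons big_cat !big_map /=.
(* At [b] nothing is left to read, so only the empty word fits; elsewhere the balance provides a
   letter departing from [a]. *)
have [ab|ab] := eqVneq a b.
  subst a; rewrite !cb /= !big1 ?addr0 //; try by move=> ?; rewrite andbF.
  rewrite expr0 mul1r; congr mass.
  by apply/funext => y; rewrite /rest subn0.
have := bal a; rewrite eqxx (negPf ab) /= => bal_a.
have c_gt0 : (0 < c (a, true) + c (a, false))%N by lia.
have a_vs : a \in vs.
  by move: c_gt0; rewrite addn_gt0 => /orP[]; apply: c_vs.
have IH x : (0 < c (a, x))%N -> mass vs (sub1 c (a, x)) =
    \sum_(w <- words N | (endp (a + stp x) w == b) && fits (a + stp x) w (sub1 c (a, x)))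
      'X^(expo (a + stp x) w (sub1 c (a, x)))
      * mass vs (rest (a + stp x) w (sub1 c (a, x))).
  move=> cx; apply: IHN.
  - by move=> v y cv; apply: (c_vs v y); apply: leq_trans cv (leq_subr _ _).
  - by move=> y; rewrite /sub1 cb.
  - exact: balanced_sub1.
  move: cN; rewrite (bigD1_seq a) // [in X in _ -> X](bigD1_seq a) //=.
  rewrite /sub1 !xpair_eqE eqxx /=.
  rewrite [X in _ -> (_ + X <= _)%N](eq_bigr (fun v => c (v, true) + c (v, false))%N).
    by case: x cx => /=; lia.
  by move=> i /negPf ia; rewrite !xpair_eqE ia !subn0.
rewrite (mass_sub1 Uvs a_vs c_gt0); congr (_ + _).
  case: ifP => [cx|_]; last by rewrite big1 // => i; rewrite andbF.
  rewrite IH // mulr_sumr; apply: eq_bigr => w _.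
  by rewrite exprD mulrA rest_cons.
case: ifP => [cx|_]; last by rewrite big1 // => i; rewrite andbF.
by rewrite IH //; apply: eq_bigr => w _; rewrite add0n rest_cons.
Qed.
End Walk.

(** * Reversal of paths *)

Lemma count_revneg x w : count_mem x (revneg w) = count_mem (~~ x) w.
Proof. by rewrite /revneg count_rev count_map; apply: eq_count => y; case: x; case: y. Qed.

Section Reversal.
Variables (V : zmodType) (e s : V).
Implicit Types (u v a b : V) (w : seq bool) (c r : V * bool -> nat).

Local Notation tr := (trace e s).
Local Notation ep := (endp e s).
Local Notation st := (stp e s).
Local Notation tr' := (trace (- s) (- e)).
Local Notation ep' := (endp (- s) (- e)).

(* The first step is taken apart because a and b may coincide. *)
Lemma mass_expand_cons vs N a b c : uniq vs ->
  (forall v x, (0 < c (v, x))%N -> v \in vs) ->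
  c (a, true) = 0%N -> c (a, false) = 1%N ->
  (b != a -> forall x, c (b, x) = 0%N) -> balanced e s a b c ->
  (\sum_(v <- vs) (c (v, true) + c (v, false)) <= N.+1)%N ->
  mass vs c =
  \sum_(w <- words N.+1 | [&& w != [::], ep a w == b & fits e s a w c])
     'X^(expo e s a w c) * mass vs (rest e s a w c).
Proof.
move=> Uvs c_vs cat caf cb bal cN.
have a_vs : a \in vs by apply: (c_vs a false); rewrite caf.
rewrite (mass_sub1 Uvs a_vs) ?cat ?caf //= add0r.
rewrite big_cons big_cat !big_map /= cat /= big1 ?add0r; last first.
  by move=> w; rewrite andbF.
(* Once the only letter of [a] is read, nothing departs from [b], even if [b] is [a]. *)
rewrite (@mass_expand _ e s vs N (a + s) b) //.
- rewrite caf; apply: eq_big => // w _.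
  by rewrite add0n rest_cons.
- by move=> v x cv; apply: (c_vs v x); apply: leq_trans cv (leq_subr _ _).
- move=> x; rewrite /sub1; have [->|ba] := eqVneq b a; last by rewrite cb.
  by rewrite xpair_eqE eqxx; case: x; rewrite ?cat ?caf.
- by apply: (@balanced_sub1 _ e s a b c false) bal; rewrite caf.
move: cN; rewrite (bigD1_seq a) // [in X in _ -> X](bigD1_seq a) //=.
rewrite /sub1 !xpair_eqE eqxx /= cat caf.
rewrite [X in _ -> (_ + X <= _)%N](eq_bigr (fun v => c (v, true) + c (v, false))%N) //.
by move=> i /negPf ia; rewrite !xpair_eqE ia !subn0.
Qed.

Lemma trace_rev u w : tr' (ep u w) (revneg w) =
  rev [seq (y.1 + st y.2, ~~ y.2) | y <- tr u w] /\
  ep' (ep u w) (revneg w) = u.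
Proof.
elim: w u => [|x w IHw] u; first by [].
rewrite revneg_cons -cats1 trace_cat endp_cat /=.
have [-> ->] := IHw (u + st x); rewrite /= rev_cons cats1.
by split; case: x => //=; rewrite /stp /= addrK.
Qed.

(* Multiplicities of the reversed edges, the step s becoming the horizontal one. *)
Definition crev c : V * bool -> nat :=
  fun y => c (y.1 - st (~~ y.2), ~~ y.2).

Lemma count_trace_rev u w :
  (fun y => count_mem y (tr' (ep u w) (revneg w))) =
  crev (fun y => count_mem y (tr u w)).
Proof.
apply/funext => -[v x]; rewrite (trace_rev u w).1 count_rev count_map /crev /=.
apply: eq_count => -[v' x'] /=; rewrite !xpair_eqE /= [in RHS]eq_sym subr_eq eq_sym.
by case: x x' => -[]; rewrite /= ?andbF.
Qed.

Lemma fits_rev u w c : fits (- s) (- e) (ep u w) (revneg w) (crev c) = fits e s u w c.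
Proof.
have E y : count_mem y (tr' (ep u w) (revneg w)) =
    crev (fun y => count_mem y (tr u w)) y by rewrite -count_trace_rev.
apply/fitsP/fitsP => le_c; last by move=> y; rewrite E; apply: le_c.
move=> [v x]; have := le_c (v + st x, ~~ x).
by rewrite E /crev /= negbK addrK.
Qed.

Lemma rest_rev u w c :
  rest (- s) (- e) (ep u w) (revneg w) (crev c) = crev (rest e s u w c).
Proof.
by apply/funext => y; rewrite /rest; have /(congr1 (@^~ y)) -> := count_trace_rev u w.
Qed.

(** Reversal turns arrivals into departures, hence departure inversions of the reversed path into
    arrival inversions of the path. *)
Lemma vsum_rev w : vsum (- s) (- e) (fun g => g == 0) (revneg w) =
  vsum e s (fun g => g == e - s) w.
Proof.
rewrite /vsum psum_revneg; apply: eq_psum => -[//|i] j _ /=; congr nat_of_bool.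
rewrite !mulNrn -opprD oppr_eq0 [s *+ j.+1]mulrS [e *+ i.+1]mulrS.
rewrite -[RHS]subr_eq0; congr (_ == 0); rewrite opprB.
by rewrite [RHS]addrC -!addrA addKr [e *+ i + _]addrC.
Qed.

(** The letters left over for the reversed path are the unread horizontal edges that arrive where a
    vertical step of [w] arrives. *)
Lemma expo_rev u w c : fits e s u w c ->
  expo (- s) (- e) (ep u w) (revneg w) (crev c) =
  (vsum e s (fun g => g == (e - s)%R) w +
   \sum_(y <- tr u w | ~~ y.2) rest e s u w c ((y.1 + s - e)%R, true))%N.
Proof.
rewrite -fits_rev => /expoE ->; rewrite vsum_rev rest_rev (trace_rev u w).1.
congr addn; rewrite (perm_big _ (permEl (perm_rev _))) big_map /=.
by apply: eq_bigr => -[v []].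
Qed.

Lemma balanced_rev a b c : balanced e s a b c -> balanced (- s) (- e) b a (crev c).
Proof.
move=> bal v; have := bal v; rewrite /crev /= /stp /= !opprK !addrK.
by set A := v == a; set B := v == b; lia.
Qed.

Lemma big_shift (R : comNzRingType) (vs : seq V) (h : V) (g : V -> R) : uniq vs ->
  (forall v, g v != 1 -> v \in vs /\ v + h \in vs) ->
  \prod_(v <- vs) g (v - h) = \prod_(v <- vs) g v.
Proof.
move=> Uvs g_vs.
have E (f : V -> R) : \prod_(v <- vs) f v = \prod_(v <- vs | f v != 1) f v.
  by rewrite [RHS]big_mkcond; apply: eq_bigr => v _; case: eqP => /= [->|].
rewrite E [RHS]E -big_filter -[RHS]big_filter -(big_map (fun v => v - h) xpredT g).
apply: perm_big; apply: uniq_perm; rewrite ?filter_uniq //.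
  by rewrite map_inj_uniq ?filter_uniq //; apply: addIr.
move=> v; rewrite mem_filter; apply/mapP/andP => [[y + ->]|[gv v_vs]].
  by rewrite mem_filter => /andP[gy _]; split=> //; case: (g_vs _ gy).
by exists (v + h); rewrite ?addrK // mem_filter addrK gv; case: (g_vs _ gv).
Qed.

(** Multiplied by the q-factorials of all edge multiplicities, the mass is the product of the
    q-factorials of the out-degrees, and after reversal that of the in-degrees. Comparing
    q-factorials instead of degrees leaves room for the ends of a path, where the degrees may be 0
    and 1. *)
Lemma mass_rev vs c : uniq vs ->
  (forall v x, (0 < c (v, x))%N -> v \in vs /\ v + st x \in vs) ->
  (forall v, qfact (c (v, true) + c (v, false))
             = qfact (c ((v - e)%R, true) + c ((v - s)%R, false))) ->
  mass vs (crev c) = mass vs c.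
Proof.
move=> Uvs c_vs bal.
have shift x : \prod_(v <- vs) qfact (c (v - st x, x)) = \prod_(v <- vs) qfact (c (v, x)).
  apply: (@big_shift _ vs (st x) (fun v => qfact (c (v, x)))) => // v cv.
  by apply: c_vs; rewrite lt0n; apply: contra cv => /eqP->.
apply: (@mulIf _ (\prod_(v <- vs) (qfact (c (v, true)) * qfact (c (v, false))))).
  by rewrite prodf_seq_neq0; apply/allP => v _; rewrite mulf_neq0 ?qfact_neq0.
have -> : mass vs c * \prod_(v <- vs) (qfact (c (v, true)) * qfact (c (v, false)))
    = \prod_(v <- vs) qfact (c (v, true) + c (v, false)).
  by rewrite /mass -big_split /=; apply: eq_bigr => v _; rewrite qbin_fact.
rewrite big_split /= -(shift true) -(shift false) mulrC [X in X * _]mulrC -big_split.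
rewrite mulrC /mass -big_split /=; apply: eq_bigr => v _.
by rewrite /crev /= qbin_fact bal addnC.
Qed.
End Reversal.

Lemma eq_sum_classes (T : eqType) (R : nmodType) (r : rel T) (ws : seq T) (f g : T -> R) :
  equivalence_rel r ->
  (forall x, x \in ws -> \sum_(y <- ws | r x y) f y = \sum_(y <- ws | r x y) g y) ->
  \sum_(y <- ws) f y = \sum_(y <- ws) g y.
Proof.
move=> rE; have [n] := ubnP (size ws); elim: n ws => // n IHn [|x ws] ws_n fg.
  by rewrite !big_nil.
rewrite (bigID (r x)) [RHS](bigID (r x)) /= fg ?mem_head //; congr (_ + _).
rewrite -big_filter -[RHS]big_filter; apply: IHn.
  rewrite /= (rE x x x).1 /= -ltnS; apply: leq_ltn_trans ws_n => /=; rewrite ltnS.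
  by rewrite size_filter count_size.
move=> y; rewrite mem_filter => /andP[xy y_ws]; have := fg y y_ws.
rewrite !big_filter_cond !(big_mkcond (r y)) => E.
have H z : ~~ r x z && r y z = r y z.
  case yz: (r y z); rewrite ?andbF // andbT; apply: contra xy => xz.
  by rewrite ((rE x z y).2 xz) -((rE y z y).2 yz) (rE y y y).1.
rewrite (eq_bigl _ _ H) [RHS](eq_bigl _ _ H).
by rewrite big_mkcond [RHS]big_mkcond.
Qed.

(** * Equidistribution of departure and arrival inversions *)

Section Visits.
Variables (V : zmodType) (e s : V).
Implicit Types (u v a b : V) (w : seq bool) (c r : V * bool -> nat).

Local Notation tr := (trace e s).
Local Notation ep := (endp e s).

Definition same a w1 w2 := perm_eq (tr a w1) (tr a w2).

Definition visits a w : V * bool -> nat := fun y => count_mem y (tr a w).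

Lemma count_trace u w x : count (fun y => y.2 == x) (tr u w) = count_mem x w.
Proof. by elim: w u => //= y w IHw u; rewrite IHw. Qed.

Lemma same_equiv a : equivalence_rel (same a).
Proof.
move=> x y z; split; first exact: perm_refl.
by move=> xy; rewrite /same; apply/idP/idP => /(perm_trans _); apply=> //; rewrite perm_sym.
Qed.

Lemma same_endp a w1 w2 : same a w1 w2 -> ep a w1 = ep a w2.
Proof. by move=> /permP E; rewrite !endpE -!(count_trace a) !E. Qed.

Lemma balanced_visits a w : balanced e s a (ep a w) (visits a w).
Proof.
elim: w a => [|x w IHw] a v; first by [].
have := IHw (a + stp e s x) v; rewrite /visits /= !xpair_eqE.
have -> : (v == a + stp e s x) = (a == v - stp e s x) by rewrite [RHS]eq_sym subr_eq.
rewrite [in X in _ -> X](eq_sym v a).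
case: x; rewrite /stp /= ?andbT ?andbF.
  by set A := a == v; set B := a == v - e; set C := v == _; lia.
by set A := a == v; set B := a == v - s; set C := v == _; lia.
Qed.

Lemma sum_visits vs a w : uniq vs ->
  (\sum_(v <- vs) (visits a w (v, true) + visits a w (v, false)) <= size w)%N.
Proof.
move=> Uvs; rewrite -(size_trace e s a w) /visits.
elim: (tr a w) => [|[u x] r IHr] /=; first by rewrite big1.
rewrite (eq_bigr (fun v => (u == v) + (count_mem (v, true) r + count_mem (v, false) r))%N).
  rewrite big_split -[X in (_ <= X)%N]add1n leq_add //.
  have -> : (\sum_(i <- vs) (u == i))%N = count_mem u vs.
    by rewrite -sum1_count [RHS]big_mkcond; apply: eq_bigr => i _; rewrite /= eq_sym; case: eqP.
  by rewrite count_uniq_mem //; case: (_ \in _).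
by move=> v _; rewrite !xpair_eqE; case: x; rewrite /= ?andbT ?andbF; set A := u == v; lia.
Qed.

End Visits.

Section Classes.
Variables (V : zmodType) (e s : V).
Implicit Types (u v a b : V) (w : seq bool) (c r : V * bool -> nat).

Local Notation tr := (trace e s).
Local Notation ep := (endp e s).
Local Notation st := (stp e s).
Local Notation fit := (fits e s).
Local Notation rst := (rest e s).
Local Notation vsm := (vsum e s).

Local Notation vis := (visits e s).
Local Notation sam := (same e s).

(* [psi] is a potential of the circulation r: along a path it varies by the flow
   of r across the step, so both sums agree when it vanishes at the ends. *)
Lemma pairing u w r J :
  (forall v, r (v, true) + r (v, false)
             = r ((v - e)%R, true) + r ((v - s)%R, false))%N ->
  (forall y, y \in tr u w ->
     r (y.1 + (e - s) *+ J.+1, false) = 0%N /\ r (y.1 + (e - s) *+ J, true) = 0%N) ->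
  let psi v := (\sum_(j < J.+1) (r ((v + (e - s) *+ j)%R, true)
                                 + r ((v + (e - s) *+ j)%R, false)))%N in
  (\sum_(y <- tr u w | y.2) r (y.1, false) + psi (ep u w) =
   psi u + \sum_(y <- tr u w | ~~ y.2) r ((y.1 + s - e)%R, true))%N.
Proof.
move=> bal; elim: w u => [|x w IHw] u r0 psi /=; first by rewrite !big_nil addn0.
have {}IHw := IHw (u + st x) (fun y Hy => r0 y (@mem_behead _ (tr u (x :: w)) y Hy)).
have [rf rt] := r0 _ (mem_head _ _); rewrite {r0}/= in rf rt.
rewrite !big_cons; case: x IHw => /= IHw.
  rewrite -addnA IHw addnA; congr addn.
  rewrite /psi (eq_bigr (fun j : 'I__ => r ((u + (e - s) *+ j)%R, true)
                           + r ((u + (e - s) *+ j.+1)%R, false))%N); last first.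
    move=> j _; rewrite bal mulrS; congr (r (_, _) + r (_, _))%N.
      by rewrite addrAC addrK.
    by rewrite !addrA addrAC.
  rewrite !big_split /= [X in (_ + (_ + X))%N = _]big_ord_recr /= rf addn0.
  rewrite [X in _ = (_ + X)%N]big_ord_recl /= mulr0n addr0 addnCA.
  by congr (_ + (_ + _))%N; apply: eq_bigr => j _; rewrite /bump.
rewrite IHw addnCA addnA; congr addn.
rewrite /psi (eq_bigr (fun j : 'I__ => r ((u + s - e + (e - s) *+ j)%R, true)
                         + r ((u + (e - s) *+ j)%R, false))%N); last first.
  move=> j _; rewrite bal; congr (r (_, _) + r (_, _))%N; first by rewrite addrAC.
  by rewrite addrAC addrK.
rewrite !big_split /= big_ord_recl /= mulr0n addr0 -addnA; congr addn; congr addn.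
rewrite [RHS]big_ord_recr /= rt addn0; apply: eq_bigr => j _; rewrite /bump /= mulrS.
by rewrite !addrA [u + s - e + e]addrNK addrK.
Qed.

(** * Paths staying below the level of their origin *)

Variable lv : {additive V -> int}.
Hypotheses (e_gt0 : 0 < lv e) (s_lt0 : lv s < 0).

Definition tame a w : bool :=
  if w is false :: w' then
    all (fun y => lv y.1 < lv a) (tr (a + s) w') && (lv (ep a w) == lv a)
  else false.

Lemma tame_visits a w : tame a w ->
  [/\ vis a w (a, true) = 0%N, vis a w (a, false) = 1%N &
      forall v x, (0 < vis a w (v, x))%N -> (v, x) = (a, false) \/ lv v < lv a].
Proof.
case: w => [|[] w] //= /andP[/allP low _]; rewrite /visits /= !xpair_eqE eqxx /=.
have c0 x : count_mem (a, x) (tr (a + s) w) = 0%N.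
  by apply/count_memPn/negP => /low; rewrite ltxx.
split; rewrite ?c0 // => v x; rewrite xpair_eqE.
case: andP => [[/eqP-> /eqP<-] _|_]; first by left.
by rewrite add0n -has_count => /hasP[y /low + /eqP yE]; rewrite yE; right.
Qed.

(** On or above the level of [a], the only available edge is one descending edge at [a]; [w] must
    start with it, and its other edges lie lower. *)
Lemma tame_sub a w0 w : tame a w0 -> w != [::] -> ep a w = ep a w0 ->
  fit a w (vis a w0) -> tame a w.
Proof.
move=> w0T; have [ct cf low] := tame_visits w0T.
have lv_b : lv (ep a w0) = lv a.
  by case: w0 w0T {ct cf low} => [|[] w0] //= /andP[_ /eqP].
case: w => // x w _ wE /fitsP fw; case: x wE fw => wE fw.
  by have := fw (a, true); rewrite ct /= eqxx.
rewrite /tame wE lv_b eqxx andbT; apply/allP => y y_w.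
have c_y : (0 < count_mem y (tr (a + s) w))%N.
  by rewrite -has_count; apply/hasP; exists y; rewrite /= ?eqxx.
have c_y0 : (0 < vis a w0 (y.1, y.2))%N.
  by rewrite -surjective_pairing (leq_trans _ (fw y)) //= ltn_addl.
case: (low _ _ c_y0) => [|//]; rewrite -surjective_pairing => yE.
by have := fw (a, false); rewrite cf /= eqxx -yE add1n ltnS leqNgt c_y.
Qed.

(** This is the difference of two flows with the same source and sink. *)
Lemma rest_circulation a w c b : balanced e s a b c -> ep a w = b -> fit a w c ->
  forall v, (rst a w c (v, true) + rst a w c (v, false)
             = rst a w c ((v - e)%R, true) + rst a w c ((v - s)%R, false))%N.
Proof.
move=> bal wb /fitsP fw v; have := bal v; have := balanced_visits e s a w v.
rewrite wb /visits /rst.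
have := fw (v, true); have := fw (v, false).
have := fw (v - e, true); have := fw (v - s, false).
by set A := v == a; set B := v == b; lia.
Qed.

Section Mass.
Variables (N : nat) (vs : seq V) (a : V) (w0 : seq bool).
Hypotheses (w0_tame : tame a w0) (w0_N : (size w0 <= N)%N) (Uvs : uniq vs).
Hypothesis vs_w0 : forall v x, (0 < vis a w0 (v, x))%N -> v \in vs /\ v + st x \in vs.
Let c := vis a w0.
Let b := ep a w0.

Let lv_b : lv b = lv a.
Proof. by case: w0 w0_tame @b => [|[] w] //= /andP[_ /eqP]. Qed.

Let bal : balanced e s a b c. Proof. exact: balanced_visits. Qed.

Let c_eq0 v x : (v, x) != (a, false) -> lv a <= lv v -> c (v, x) = 0%N.
Proof.
have [_ _ low] := tame_visits w0_tame.
move=> vx va; apply/eqP; rewrite -leqn0 leqNgt; apply/negP => /low[/eqP|].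
  by rewrite (negPf vx).
by rewrite ltNge va.
Qed.

Lemma mass_deps : mass vs c =
  \sum_(w <- words N | [&& w != [::], ep a w == b & fit a w c])
    'X^(vsm (fun g => g == 0) w + \sum_(y <- tr a w | y.2) rst a w c (y.1, false))
    * mass vs (rst a w c).
Proof.
have [ct cf low] := tame_visits w0_tame.
case: N w0_N => [|N' w0_N']; first by case: w0 w0_tame.
rewrite (@mass_expand_cons _ e s vs N' a b) //.
- by apply: eq_bigr => w /and3P[_ _ fw]; rewrite expoE.
- by move=> v x /vs_w0[].
- move=> ba x; apply: c_eq0; last by rewrite lv_b.
  by rewrite xpair_eqE (negPf ba).
by apply: leq_trans (sum_visits e s a w0 Uvs) _.
Qed.

Lemma mass_arrs : mass vs c =
  \sum_(w <- words N | [&& w != [::], ep a w == b & fit a w c])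
    'X^(vsm (fun g => g == e - s) w
        + \sum_(y <- tr a w | ~~ y.2) rst a w c ((y.1 + s - e)%R, true))
    * mass vs (rst a w c).
Proof.
have [ct cf low] := tame_visits w0_tame.
rewrite -(@mass_rev _ e s vs c Uvs vs_w0); last first.
  (* The two degrees differ only at [a] and [b], when these are distinct; they are then 0 and 1, and
     [0]! = [1]!. *)
  move=> v; have := bal v; have q1 : qfact 1 = qfact 0.
    by rewrite /= big_ord1 mul1r expr0.
  have [->|va] := eqVneq v a; have [ab|ab] := eqVneq _ b.
  - by move=> /addIn ->.
  - by rewrite /c ct cf addn0 => /addIn <-.
  - rewrite ab !(@c_eq0 b) ?lv_b ?xpair_eqE -?ab ?(negPf va) //.
    by rewrite !addn0 add0n => <-.
  by rewrite !addn0 => ->.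
(* A vertical edge into [b] would come from above the level of [a]. Thus a single edge enters [b], a
   horizontal one, and the first step of the reversed path is forced. *)
have cb : c (b - e, true) = 1%N.
  have := bal b; rewrite eqxx.
  rewrite (@c_eq0 (b - s) false); last 2 first.
  - apply/eqP => -[sb]; have := lv_b; rewrite -[b](subrK s) sb raddfD /=.
    by move=> /eqP; rewrite -subr_eq0 addrAC subrr add0r lt_eqF //.
  - by rewrite raddfB lv_b lerBrDr gerDl ltW.
  have [->|ba] := eqVneq b a; first by rewrite /c ct cf; lia.
  by rewrite !(@c_eq0 b) ?lv_b ?xpair_eqE ?(negPf ba) //; lia.
case: N w0_N => [|N' w0_N']; first by case: w0 w0_tame.
rewrite (@mass_expand_cons _ (- s) (- e) vs N' b a) //.
- have P w : [&& revneg w != [::], endp (- s) (- e) b (revneg w) == a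
      & fits (- s) (- e) b (revneg w) (crev e s c)]
      = [&& w != [::], ep a w == b & fit a w c].
    rewrite -size_eq0 size_revneg size_eq0; congr andb.
    have -> : (endp (- s) (- e) b (revneg w) == a) = (ep a w == b).
      by rewrite !endpE !count_revneg /= !mulNrn !subr_eq eq_sym.
    by case: eqP => //= wb; rewrite -{1}wb fits_rev.
  rewrite big_words_revneg; apply: eq_big => [|w]; first exact: P.
  rewrite P => /and3P[_ /eqP wb fw].
  rewrite -wb expo_rev // rest_rev mass_rev //.
    by move=> v x rv; apply: vs_w0; apply: leq_trans rv (leq_subr _ _).
  by move=> v; rewrite (rest_circulation bal wb fw).
- move=> v x; rewrite /crev /=; case: x => /= /vs_w0[]; by rewrite subrK.
- rewrite /crev /= c_eq0 //.
    apply/eqP => -[sb]; have := lv_b; rewrite -[b](subrK s) sb raddfD /=.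
    by move=> /eqP; rewrite -subr_eq0 addrAC subrr add0r lt_eqF.
  by rewrite raddfB lv_b lerBrDr gerDl ltW.
- move=> ab [] /=; rewrite /crev /=.
    apply: c_eq0; last by rewrite raddfB lerBrDr gerDl ltW.
    apply/eqP => -[/eqP]; rewrite -subr_eq0 addrAC subrr add0r oppr_eq0 => /eqP s0.
    by move: s_lt0; rewrite s0 raddf0 ltxx.
  have := bal a; rewrite /c ct cf eqxx (negPf ab); rewrite /c /stp /=; lia.
- exact: balanced_rev.
apply: leq_trans _ w0_N'.
have E : crev e s c = fun y => count_mem y (trace (- s) (- e) b (revneg w0)).
  by rewrite count_trace_rev.
by rewrite E; have := sum_visits (- s) (- e) b (revneg w0) Uvs; rewrite size_revneg.
Qed.
End Mass.

Lemma rest_high a w0 w v x : tame a w0 -> w != [::] -> ep a w = ep a w0 ->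
  fit a w (vis a w0) -> lv a <= lv v -> rst a w (vis a w0) (v, x) = 0%N.
Proof.
move=> w0T w_n0 wb fw va; have [ct cf low] := tame_visits w0T.
have wT := tame_sub w0T w_n0 wb fw; have [_ cf' _] := tame_visits wT.
apply/eqP; rewrite -leqn0 leqNgt; apply/negP => r_gt0.
have c_gt0 : (0 < vis a w0 (v, x))%N by apply: leq_trans r_gt0 (leq_subr _ _).
case: (low _ _ c_gt0) => [vx|]; last by rewrite ltNge va.
by move: r_gt0; rewrite /rest vx cf [count_mem _ _]cf'.
Qed.

(** The leftover circulation lies strictly below [a] and e - s points upwards, so the potential of
    [pairing] vanishes at both ends of the path. *)
Lemma pairing_eq a w0 w : tame a w0 -> w != [::] -> ep a w = ep a w0 ->
  fit a w (vis a w0) ->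
  (\sum_(y <- tr a w | y.2) rst a w (vis a w0) (y.1, false) =
   \sum_(y <- tr a w | ~~ y.2) rst a w (vis a w0) ((y.1 + s - e)%R, true))%N.
Proof.
move=> w0T w_n0 wb fw; set r := rst _ _ _.
have r0 v x : lv a <= lv v -> r (v, x) = 0%N by apply: rest_high.
have D_gt0 : 1 <= lv (e - s) by rewrite raddfB -gtz0_ge1 subr_gt0 (lt_trans s_lt0).
have lv_b : lv (ep a w) = lv a.
  by rewrite wb; case: w0 w0T {wb fw r r0} => [|[] w0] //= /andP[_ /eqP].
have up v j : lv a <= lv v + j%:Z -> lv a <= lv (v + (e - s) *+ j).
  move=> /le_trans; apply; rewrite raddfD /= lerD2l raddfMn /= -mulr_natr.
  by rewrite -[leLHS]mul1r ler_pM // natz.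
have up0 v j : lv a <= lv v -> lv a <= lv (v + (e - s) *+ j).
  by move=> va; apply: up; rewrite (le_trans va) // lerDl.
(* Each translation by e - s gains at least one level, and no departure vertex lies more than [J]
   levels below [a]. *)
pose J := (\sum_(y <- tr a w) `|(lv a - lv y.1)%R|)%N.
have upJ y : y \in tr a w -> lv a <= lv y.1 + J%:Z.
  move=> y_w; rewrite -lerBlDl (le_trans (ler_norm _)) // -abszE lez_nat /J.
  by rewrite (big_rem y) //= leq_addr.
have := @pairing a w r J (rest_circulation (balanced_visits e s a w0) wb fw).
have psi0 v : lv a <= lv v -> (\sum_(j < J.+1) (r ((v + (e - s) *+ j)%R, true)
                                 + r ((v + (e - s) *+ j)%R, false)))%N = 0%N.
  by move=> va; rewrite big1 // => j _; rewrite !r0 ?up0.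
rewrite /= !psi0 ?lv_b // addn0 add0n; apply => y /upJ yJ.
by rewrite !r0 ?up // (le_trans yJ) // lerD2l lez_nat.
Qed.

(** Both expansions of the mass run over the paths that fit into the edges of [w0], with the same
    cofactors. The classes of paths using fewer edges contribute equally by induction; there remain
    the paths using all edges, with cofactor 1. *)
Lemma eq_deps_arrs N a w0 : tame a w0 -> (size w0 <= N)%N ->
  \sum_(w <- words N | sam a w0 w) 'X^(vsm (fun g => g == 0) w) =
  \sum_(w <- words N | sam a w0 w) 'X^(vsm (fun g => g == e - s) w) :> {poly int}.
Proof.
have [n] := ubnP (size w0); elim: n w0 => // n IHn w0 w0_n w0T w0_N.
pose c := vis a w0; pose b := ep a w0.
pose vs := undup ([seq y.1 | y <- tr a w0] ++ [seq y.1 + st y.2 | y <- tr a w0]).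
have Uvs : uniq vs by apply: undup_uniq.
have vs_w0 v x : (0 < vis a w0 (v, x))%N -> v \in vs /\ v + st x \in vs.
  rewrite -has_count => /hasP[y y_w0 /eqP yE].
  rewrite !mem_undup !mem_cat; split; apply/orP; [left|right].
    by apply/mapP; exists y => //; rewrite yE.
  by apply/mapP; exists y => //; rewrite yE.
pose om w := [&& w != [::], ep a w == b & fit a w c].
pose G w := 'X^(\sum_(y <- tr a w | y.2) rst a w c (y.1, false)) * mass vs (rst a w c).
have E : \sum_(w <- words N | om w) 'X^(vsm (fun g => g == 0) w) * G w =
         \sum_(w <- words N | om w) 'X^(vsm (fun g => g == e - s) w) * G w.
  transitivity (mass vs c).
    rewrite (mass_deps w0T w0_N Uvs vs_w0); apply: eq_bigr => w _.
    by rewrite exprD mulrA.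
  rewrite (mass_arrs w0T w0_N Uvs vs_w0); apply: eq_bigr => w /and3P[w_n0 /eqP wb fw].
  by rewrite /G (pairing_eq w0T) // exprD mulrA.
have cE w : sam a w0 w -> vis a w = c by move=> /permP w_w0; apply/funext => y; rewrite /visits -w_w0.
have om_same w : sam a w0 w -> om w.
  move=> w_w0; apply/and3P; split.
  - rewrite -size_eq0 -(size_trace e s a) -(perm_size w_w0) size_trace size_eq0.
    by case: w0 w0T {w0_n w0_N c b vs Uvs vs_w0 om G E cE w_w0}.
  - by rewrite -(same_endp w_w0).
  by apply/fitsP => y; rewrite -(cE w).
have G_same w : sam a w0 w -> G w = 1.
  move=> w_w0; rewrite /G; have r0 y : rst a w c y = 0%N by rewrite /rest -(cE w) ?subnn.
  rewrite big1 // expr0 mul1r /mass big1 // => v _.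
  by rewrite !r0.
have rest_eq : \sum_(w <- words N | om w && ~~ sam a w0 w) 'X^(vsm (fun g => g == 0) w) * G w =
         \sum_(w <- words N | om w && ~~ sam a w0 w) 'X^(vsm (fun g => g == e - s) w) * G w.
  rewrite -big_filter -[RHS]big_filter; apply: (eq_sum_classes (same_equiv e s a)) => x.
  rewrite mem_filter => /andP[/andP[/and3P[x_n0 /eqP xb fx] x_w0] x_N].
  have om_x w : sam a x w -> (om w && ~~ sam a w0 w) && sam a x w = sam a x w.
    move=> x_w; rewrite x_w andbT; apply/andP; split; last first.
      by apply: contra x_w0 => w_w0; apply: (perm_trans w_w0); rewrite perm_sym.
    apply/and3P; split.
    - by rewrite -size_eq0 -(size_trace e s a) -(perm_size x_w) size_trace size_eq0.
    - by rewrite -(same_endp x_w) xb.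
    by apply/fitsP => y; rewrite -(permP x_w); move/fitsP: fx; apply.
  have G_x w : sam a x w -> G w = G x.
    move=> x_w; rewrite /G; have -> : rst a w c = rst a x c.
      by apply/funext => y; rewrite /rest (permP x_w).
    by rewrite (perm_big _ x_w).
  have red f : \sum_(w <- [seq w <- words N | om w && ~~ sam a w0 w] | sam a x w) f w * G w
      = (\sum_(w <- words N | sam a x w) f w) * G x.
    rewrite big_filter_cond mulr_suml; apply: eq_big => [w|w /andP[_ /G_x ->] //].
    by case xw: (sam a x w); [move: (om_x w xw); rewrite xw | rewrite andbF].
  rewrite !red IHn //; last 2 first.
  - exact: tame_sub w0T x_n0 xb fx.
  - by rewrite -mem_words.
  apply: leq_trans (_ : size w0 <= n)%N; last by rewrite -ltnS.
  (* The edges of [x] form a sub-multiset of those of [w0]; with equal sizes, [x] would be in the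
     class of [w0]. *)
  have /count_subseqP[r r_w0 r_x] : forall y, (count_mem y (tr a x) <= count_mem y (tr a w0))%N.
    exact/fitsP.
  rewrite -(size_trace e s a x) -(size_trace e s a w0) (perm_size r_x) ltn_neqAle size_subseq //.
  rewrite andbT; apply: contra x_w0 => /eqP rE; rewrite /same perm_sym.
  by have := size_subseq_leqif r_w0; rewrite rE => -[_]; rewrite eqxx => /esym/eqP <-.
move: E; rewrite (bigID (sam a w0)) [in X in _ = X](bigID (sam a w0)) /= rest_eq => /addIr.
have red f : \sum_(w <- words N | om w && sam a w0 w) f w * G w
    = \sum_(w <- words N | sam a w0 w) f w.
  apply: eq_big => [w|w /andP[_ /G_same ->]]; last by rewrite mulr1.
  by case ww: (sam a w0 w); rewrite ?andbF // om_same.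
by rewrite !red.
Qed.
End Classes.

(** * Statistics determined by the edges *)

Lemma eq_psumD F1 F2 F w : (forall i j, (0 < i)%N -> F i j = (F1 i j + F2 i j)%N) ->
  psum F w = (psum F1 w + psum F2 w)%N.
Proof.
move=> FE; have kE X Y v : (0 < X)%N -> ksum F X Y v = (ksum F1 X Y v + ksum F2 X Y v)%N.
  by elim: v X Y => [|[] v IHv] X Y X0 //=; rewrite ?FE // IHv // addnACA.
by elim: w => [|[] w IHw] //=; rewrite IHw ?kE // addnACA.
Qed.

Lemma psum_const m w : psum (fun _ _ => m) w = (m * psum (fun _ _ => 1) w)%N.
Proof.
have kE X Y v : ksum (fun _ _ => m) X Y v = (m * ksum (fun _ _ => 1) X Y v)%N.
  by elim: v X Y => [|[] v IHv] X Y /=; rewrite ?muln0 ?IHv ?mulnDr ?muln1.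
by elim: w => [|[] w IHw] /=; rewrite ?muln0 // IHw mulnDr ?kE ?muln0.
Qed.

Section Symmetry.
Variables (V : zmodType) (e s : V).
Implicit Types (u v a b : V) (w : seq bool).

Local Notation tr := (trace e s).
Local Notation ep := (endp e s).
Local Notation vsm := (vsum e s).

Section Pairs.
Variables (G : V -> nat) (H : V -> int).
Hypothesis GH : forall g, (G g)%:Z = H (g + s) - H g.

Lemma telescope u v w :
  \sum_(y <- tr v w | ~~ y.2) (G (y.1 - u))%:Z
  + \sum_(y <- tr v w | y.2) (H (y.1 - u + e) - H (y.1 - u)) = H (ep v w - u) - H (v - u).
Proof.
elim: w v => [|x w IHw] v /=; first by rewrite !big_nil addr0 subrr.
rewrite !big_cons; have := IHw (v + stp e s x); case: x => /=.
  by rewrite -[v + e - u]addrAC => E; rewrite addrCA E; lra.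
by rewrite -[v + s - u]addrAC => E; rewrite -addrA E GH; lra.
Qed.

(** The sum of [G] over the vertical steps after a given horizontal step telescopes, up to
    increments of [H] at later horizontal steps. Symmetrizing [G] absorbs all that depends on the
    order: the right-hand side sees only the edges and the two ends. *)
Lemma vsum_symE u w : (vsm G w + vsm (fun g => G (e - s - g)%R) w)%N%:Z =
  \sum_(y <- tr u w | y.2) (H (ep u w - y.1) - H (y.1 - u + e))
  + \sum_(y <- tr u w | ~~ y.2) \sum_(z <- tr u w | z.2) (G (z.1 - y.1 + (e - s)))%:Z.
Proof.
elim: w u => [|x w IHw] u; first by rewrite /= !big_nil.
rewrite !(vsum_cons e s _ u) addnACA PoszD {}(IHw (u + stp e s x)).
have -> : tr u (x :: w) = (u, x) :: tr (u + stp e s x) w by [].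
have -> : ep u (x :: w) = ep (u + stp e s x) w by [].
have Hsub y : y - (u + e) + e = y - u by rewrite opprD addrA subrK.
have Hsub' y : y - (u + s) + e = y - u + (e - s) by rewrite [e - s]addrC opprD !addrA.
have := telescope u (u + stp e s x) w.
case: x; rewrite /stp; move: (ep _ w) (tr _ w) => b r; rewrite !big_cons /=.
  rewrite PoszD !(big_morph Posz PoszD (erefl 0%:Z)).
  under [X in _ + X + _ = _]eq_bigr => y _ do rewrite opprB addrC.
  rewrite [X in _ = _ + _ + X](eq_bigr (fun y => (G (u - y.1 + (e - s)))%:Z
     + \sum_(z <- r | z.2) (G (z.1 - y.1 + (e - s)))%:Z)); last first.
    by move=> y _; rewrite big_cons.
  rewrite [X in _ + (X + _) = _](eq_bigr (fun y => H (b - y.1) - H (y.1 - u))); last first.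
    by move=> y _; rewrite Hsub.
  rewrite !big_split /= !sumrN subrr add0r [u + e - u]addrAC subrr add0r.
  by move=> E; lra.
move=> _; rewrite add0r [X in _ = _ + (_ + X)](eq_bigr (fun y =>
    \sum_(z <- r | z.2) (G (z.1 - y.1 + (e - s)))%:Z)); last first.
  by move=> y _; rewrite big_cons.
rewrite addrA; congr (_ + _); rewrite -big_split; apply: eq_bigr => y _ /=.
rewrite GH Hsub' -[y.1 - u + _ + s]addrA subrK.
lra.
Qed.

Lemma same_vsum_sym a w1 w2 : same e s a w1 w2 ->
  (vsm G w1 + vsm (fun g => G (e - s - g)%R) w1 =
   vsm G w2 + vsm (fun g => G (e - s - g)%R) w2)%N.
Proof.
move=> w12; apply: (can_inj absz_nat).
rewrite !(vsum_symE a) (same_endp w12) !(perm_big _ w12) /=; congr (_ + _).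
by apply: eq_bigr => y _; rewrite (perm_big _ w12).
Qed.
End Pairs.

Variable lv : {additive V -> int}.
Hypotheses (e_gt0 : 0 < lv e) (s_lt0 : lv s < 0).

(** The constant -lv s has the primitive -lv along s and is its own mirror image. *)
Lemma same_area a w1 w2 : same e s a w1 w2 ->
  psum (fun _ _ => 1) w1 = psum (fun _ _ => 1) w2.
Proof.
move=> w12; have GH g : `|lv s|%N%:Z = - lv (g + s) - - lv g.
  by rewrite raddfD opprD opprK addrAC addNr add0r abszE ltr0_norm.
have := same_vsum_sym GH w12; rewrite /vsum !(psum_const `|lv s|%N) !addnn.
move=> /double_inj /eqP; rewrite eqn_pmul2l => [/eqP //|].
by rewrite absz_gt0 lt_eqF.
Qed.

(** [G] is its own mirror image. Its primitive at g is the sum of its values at g - s, g - 2 s, ...;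
    only finitely many are nonzero, as these points rise out of the band that supports [G]. *)
Lemma same_mid (K : pred V) a w1 w2 : (forall g, K (e - s - g) = K g) ->
  let G g := (0 < lv g < lv (e - s)) && K g : nat in
  same e s a w1 w2 -> vsm G w1 = vsm G w2.
Proof.
move=> KK G w12; pose D := lv (e - s).
have Gsym g : G (e - s - g) = G g.
  by rewrite /G KK !raddfB subr_gt0 gtrBl [X in nat_of_bool (X && _)]andbC.
pose S k g := (\sum_(j < k) G (g - s *+ j.+1)%R)%N.
pose J g := (`|lv g| + `|D|)%N.
have S_J k g : (J g <= k)%N -> S k g = S (J g) g.
  move=> /subnKC <-; rewrite /S big_split_ord /= [X in (_ + X)%N]big1 ?addn0 // => j _.
  rewrite /G; case: ltP => //= _; case: ltP => //=.
  rewrite raddfB raddfMn /= -/D -mulr_natr natz /J => lt_D; exfalso.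
  have n_le : (`|lv g| + `|D| + j).+1%:Z <= - (lv s * (`|lv g| + `|D| + j).+1%:Z).
    by rewrite -mulNr ler_peMl // -gtz0_ge1 oppr_gt0.
  have aux (x d u : int) : (`|x|%N + `|d|%N + j).+1%:Z <= - u -> x - u < d -> False by lia.
  exact: aux n_le lt_D.
have GH g : (G g)%:Z = (S (J (g + s)) (g + s))%:Z - (S (J g) g)%:Z.
  rewrite -(@S_J (J g + J (g + s)%R)%N g) ?leq_addr //.
  rewrite -(@S_J (J g + J (g + s)%R).+1 (g + s)); last by rewrite leqW ?leq_addl.
  rewrite /S big_ord_recl /= mulr1n addrK PoszD.
  rewrite (eq_bigr (fun i : 'I__ => G (g - s *+ i.+1)%R)) ?addrK // => i _.
  by rewrite [s *+ _]mulrS opprD addrA addrK.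
have := same_vsum_sym GH w12; rewrite /vsum.
have E w : psum (fun X Y => G (e - s - (e *+ X + s *+ Y))) w
           = psum (fun X Y => G (e *+ X + s *+ Y)) w.
  by apply: eq_psum => X Y _; rewrite Gsym.
by rewrite !E !addnn => /double_inj.
Qed.
End Symmetry.

(** * Crossing a wall *)

Definition area w := psum (fun _ _ => 1%N) w.

(** Boundaries of the diagrams with [N] cells in a box of [M] rows and [M'] columns. *)
Definition inbox M M' N w :=
  [&& count_mem false w == M, count_mem true w == M' & area w == N].

Definition boxsum F M M' N : {poly int} :=
  \sum_(w <- words (M + M') | inbox M M' N w) 'X^(psum F w).

(* With x = k / Q, [upper] selects the cells with a/(l+1) < x <= (a+1)/l and
   hook length divisible by n, and [lower] those with a/(l+1) <= x < (a+1)/l. *)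
Definition upper k Q n X Y : nat :=
  [&& Q * Y < k * X, k * X <= Q * Y + k + Q & n %| X + Y]%N.
Definition lower k Q n X Y : nat :=
  [&& Q * Y <= k * X, k * X < Q * Y + k + Q & n %| X + Y]%N.

Lemma ksum1 X Y w : ksum (fun _ _ => 1%N) X Y w = count_mem false w.
Proof. by elim: w X Y => [|[] w IHw] X Y //=; rewrite IHw. Qed.

Lemma area_cons x w : area (x :: w) = ((if x then count_mem false w else 0) + area w)%N.
Proof. by case: x => //=; rewrite /area /= ksum1. Qed.

Lemma area_cat w1 w2 : (count_mem true w1 * count_mem false w2 <= area (w1 ++ w2))%N.
Proof.
elim: w1 => //= x w1 IHw; rewrite area_cons count_cat.
by case: x => /=; rewrite ?mulnDl ?mul1n ?add0n // leq_add ?leq_addl.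
Qed.

Lemma trace_split (V : zmodType) (e s u : V) w y : y \in trace e s u w ->
  exists w1 w2, w = w1 ++ y.2 :: w2 /\ y.1 = endp e s u w1.
Proof.
elim: w u => //= x w IHw u; rewrite inE => /predU1P[->|/IHw[w1 [w2 [-> ->]]]].
  by exists [::], w.
by exists (x :: w1), w2.
Qed.

Lemma count_bool w : (count_mem true w + count_mem false w = size w)%N.
Proof.
by rewrite -(count_predC (pred1 true) w); congr addn; apply: eq_count => -[].
Qed.

(** At a point of the path, the X columns before it and the Y' rows after it span a rectangle inside
    the diagram, so X Y' <= N keeps the point near the two sides that meet at the corner of the box.
    The scale 2 N + 1 is large enough for the diagonal to pass beyond it. *)
Lemma path_below k Q N X X' Y Y' : (0 < k)%N -> (0 < Q)%N ->
  (X + Y)%N != 0%N -> (X' + Y')%N != 0%N ->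
  (Y + Y' = k * (2 * N).+1)%N -> (X + X' = Q * (2 * N).+1)%N ->
  (X * Y' <= N)%N -> (k * X < Q * Y)%N.
Proof.
move=> k0 Q0 XY XY' YE XE XYN; have [NY|YN] := ltnP N Y'.
  have X0 : X = 0%N.
    by case: (posnP X) => // X0; have := leq_pmull Y' X0; lia.
  by rewrite X0 muln0 muln_gt0 Q0 lt0n; move: XY; rewrite X0.
have [Y'0|Y'_gt0] := posnP Y'.
  have -> : Y = (k * (2 * N).+1)%N by rewrite -YE Y'0 addn0.
  rewrite mulnCA ltn_pmul2l // -XE. lia.
have XN : (X <= N)%N by apply: leq_trans XYN; rewrite leq_pmulr.
have kN : (k * N + k <= Y)%N by move: YE; rewrite mulnS [(2 * N)%N]mulnC mulnA; nia.
apply: leq_trans (leq_pmull Y Q0); apply: leq_trans kN.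
by have := leq_mul (leqnn k) XN; lia.
Qed.

Section Wall.
Variables (k Q n : nat).
Hypotheses (k_gt0 : (0 < k)%N) (Q_gt0 : (0 < Q)%N) (n_gt1 : (1 < n)%N).

(** A displacement has level k X - Q Y, and its second coordinate is the hook length X + Y modulo
    n. *)
Let V := (int * 'Z_n)%type.
Let e : V := (k%:Z, 1).
Let s : V := (- Q%:Z, 1).
Let lv : {additive V -> int} := fst.

Let lv_e : 0 < lv e. Proof. by []. Qed.
Let lv_s : lv s < 0. Proof. by rewrite /lv /= oppr_lt0. Qed.

Let lvE X Y : lv (e *+ X + s *+ Y) = (k * X)%:Z - (Q * Y)%:Z.
Proof.
rewrite raddfD !raddfMn /lv /= mulNrn -[k%:Z *+ X]mulr_natr -[Q%:Z *+ Y]mulr_natr.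
by rewrite !natz !PoszM.
Qed.

Let clE X Y : ((e *+ X + s *+ Y).2 == 0) = (n %| X + Y)%N.
Proof.
have -> : (e *+ X + s *+ Y).2 = (X + Y)%:R.
  by rewrite natrD; congr (_ + _); rewrite /= raddfMn.
by rewrite -val_eqE /= val_Zp_nat.
Qed.

Let K (g : V) := g.2 == 0.
Let mid (g : V) : nat := (0 < lv g < lv (e - s)) && K g.

Let KK g : K (e - s - g) = K g.
Proof. by rewrite /K /= subrr add0r oppr_eq0. Qed.

Let lv_D : lv (e - s) = (k + Q)%:Z.
Proof. by rewrite raddfB /lv /= opprK PoszD. Qed.

(** When n divides X + Y, the extreme case k X = Q Y + k + Q means displacement e - s; for [lower],
    the extreme case k X = Q Y means displacement 0. *)
Lemma upper_mid w : psum (upper k Q n) w = (vsum e s mid w + vsum e s (fun g => g == (e - s)%R) w)%N.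
Proof.
apply: eq_psumD => X Y _; rewrite /mid /upper /K lv_D lvE clE.
have -> : (e *+ X + s *+ Y == e - s) = (k * X == Q * Y + k + Q)%N && (n %| X + Y)%N.
  rewrite -clE; have := lvE X Y; move: (e *+ X + s *+ Y) => -[x y] /= ->.
  by rewrite /e /s xpair_eqE /= subrr; congr (_ && _); lia.
by case: (n %| _)%N; rewrite ?andbF // !andbT; lia.
Qed.

Lemma lower_mid w : psum (lower k Q n) w = (vsum e s mid w + vsum e s (fun g => g == 0%R) w)%N.
Proof.
apply: eq_psumD => X Y _; rewrite /mid /lower /K lv_D lvE clE.
have -> : (e *+ X + s *+ Y == 0) = (k * X == Q * Y)%N && (n %| X + Y)%N.
  rewrite -clE; have := lvE X Y; move: (e *+ X + s *+ Y) => -[x y] /= ->.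
  by rewrite xpair_eqE /=; congr (_ && _); lia.
by case: (n %| _)%N; rewrite ?andbF // !andbT; lia.
Qed.

Lemma tame_box N w : let R := (2 * N).+1 in
  inbox (k * R) (Q * R) N w -> tame e s lv 0 w.
Proof.
move=> R /and3P[/eqP cf /eqP ct /eqP aw].
have main w1 w2 : w = w1 ++ w2 -> w1 != [::] -> w2 != [::] ->
    (k * count_mem true w1 < Q * count_mem false w1)%N.
  move=> wE w1n w2n; have := area_cat w1 w2; rewrite -wE aw.
  move: cf ct; rewrite wE !count_cat; apply: (path_below k_gt0 Q_gt0).
    by rewrite count_bool size_eq0.
  by rewrite count_bool size_eq0.
case: w cf ct aw main => [|x w] cf ct aw main.
  by move: cf => /= /esym/eqP; rewrite muln_eq0 orbF eqn0Ngt k_gt0.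
have wn : w != [::].
  apply/eqP => w0; move: cf ct; rewrite w0; move: k_gt0 Q_gt0; rewrite /R.
  by case: x {main aw} => /=; nia.
case: x cf ct aw main => cf ct aw main.
  by have := main [:: true] w erefl isT wn; rewrite /= muln0 ltn0.
apply/andP; split.
  apply/allP => y /trace_split[w1 [w2 [wE ->]]].
  have := main (false :: w1) (y.2 :: w2); rewrite wE => /(_ erefl isT isT) /=.
  have -> : endp e s (0 + s) w1 = endp e s 0 (false :: w1) by [].
  by rewrite endpE add0r lvE /=; lia.
by rewrite endpE ct cf add0r lvE /=; lia.
Qed.

(** The diagonal of this box has the slope of the wall, so the paths return to level 0. On a class
    of paths with the same edges, area and [mid] are constant, and what is left are the arrival
    inversions for [upper] and the departure inversions for [lower]. *)
Lemma wall N : let R := (2 * N).+1 in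
  boxsum (upper k Q n) (k * R) (Q * R) N = boxsum (lower k Q n) (k * R) (Q * R) N.
Proof.
move=> R; rewrite /boxsum -big_filter -[RHS]big_filter.
apply: (eq_sum_classes (same_equiv e s 0)) => x; rewrite mem_filter => /andP[xin x_N].
have x_tame := tame_box xin.
rewrite !big_filter_cond.
have in_x w : same e s 0 x w -> inbox (k * R) (Q * R) N w.
  move=> xw; move: xin; rewrite /inbox /area (same_area lv_s xw).
  by rewrite -!(count_trace e s 0) !(permP xw).
have red f : \sum_(w <- words (k * R + Q * R) | inbox (k * R) (Q * R) N w && same e s 0 x w)
    'X^(vsum e s mid w + vsum e s f w)
    = 'X^(vsum e s mid x) * \sum_(w <- words (k * R + Q * R) | same e s 0 x w)
                              'X^(vsum e s f w) :> {poly int}.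
  rewrite mulr_sumr; apply: eq_big => [w|w /andP[_ xw]].
    by case xw: (same _ _ _ _ _); rewrite ?andbF // (in_x w xw).
  by rewrite exprD (same_mid lv_e lv_s KK xw).
rewrite (eq_bigr _ (fun w _ => congr1 (fun d => 'X^d) (upper_mid w))).
rewrite [RHS](eq_bigr _ (fun w _ => congr1 (fun d => 'X^d) (lower_mid w))).
rewrite !red; congr (_ * _); symmetry; apply: (eq_deps_arrs lv_e lv_s x_tame).
by rewrite -mem_words.
Qed.
End Wall.

(** * Moving the slope to zero *)

(** A first letter true would be a column of M + 1 > N cells. *)
Lemma boxsum_padS F M M' N : (N <= M)%N -> boxsum F M.+1 M' N = boxsum F M M' N.
Proof.
move=> NM; rewrite /boxsum addSn big_cons big_cat !big_map /= [X in X + _]big1 ?add0r.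
  by apply: eq_bigl => w; rewrite /inbox /= area_cons.
move=> w /and3P[/eqP cf _ /eqP aw]; move: cf aw; rewrite area_cons /= add0n => ->.
by lia.
Qed.

Lemma boxsum_swap F M M' N :
  boxsum F M M' N = boxsum (fun X Y => F Y.+1 X.-1) M' M N.
Proof.
rewrite /boxsum big_words_revneg addnC.
apply: eq_big => [w|w _]; last by rewrite psum_revneg.
by rewrite /inbox !count_revneg /area psum_revneg andbCA.
Qed.

Lemma boxsum_pad F M M' N : (N <= M)%N -> (N <= M')%N ->
  boxsum F M M' N = boxsum F N N N.
Proof.
have pad G L L' : (N <= L)%N -> boxsum G L L' N = boxsum G N L' N.
  by move=> /subnK <-; elim: (L - N)%N => // d IHd; rewrite addSn boxsum_padS ?leq_addl.
by move=> NM NM'; rewrite pad // boxsum_swap pad // -boxsum_swap.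
Qed.

Lemma eq_boxsum F F' N : (forall X Y, (0 < X <= N)%N -> F X Y = F' X Y) ->
  boxsum F N N N = boxsum F' N N N.
Proof.
move=> FF'; apply: eq_bigr => w /and3P[_ /eqP ct _]; congr ('X^_).
by apply: eq_psum => X Y; rewrite ct => /FF'.
Qed.

(** With X = l + 1 and Y = a, this is alpha l = beta (a + 1). *)
Definition special alpha beta X Y : nat := (alpha * X == beta * Y + alpha + beta)%N.

Definition flat n X Y : nat := ((Y == 0) && (n %| X))%N.

(* No critical slope lies strictly between k / Q and (k + 1) / Q. *)
Lemma lower_upper k Q n N X Y : (0 < Q)%N ->
  (forall i, (0 < i <= N)%N -> (i %| Q)%N) -> (0 < X <= N)%N ->
  lower k Q n X Y = upper k.+1 Q n X Y.
Proof.
move=> Q0 NQ XN; rewrite /lower /upper; congr (nat_of_bool _).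
congr [&& _, _ & _].
  have /dvdnP[z ->] := NQ X XN; case/andP: XN => X0 _.
  by rewrite mulnAC !ltn_pmul2r // leq_pmul2r // ltnS.
case: X XN => // -[|X] XN; first by lia.
have /dvdnP[z zE] : (X.+1 %| Q)%N by apply: NQ; lia.
have -> : (k * X.+2 < Q * Y + k + Q)%N = (k * X.+1 < z * Y.+1 * X.+1)%N.
  by rewrite mulnAC -zE; lia.
have -> : (k.+1 * X.+2 <= Q * Y + k.+1 + Q)%N = (k.+1 * X.+1 <= z * Y.+1 * X.+1)%N.
  by rewrite mulnAC -zE; lia.
by rewrite ltn_pmul2r // leq_pmul2r.
Qed.

(** A special cell satisfies alpha (X + Y) = (alpha + beta) (Y + 1), so coprimality makes alpha +
    beta divide the hook length. Conversely, if X + Y = m (alpha + beta), the two inequalities give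
    Y < alpha m <= Y + 1. *)
Lemma special_upper alpha beta f X Y : (0 < f)%N -> (0 < beta)%N -> coprime alpha beta ->
  special alpha beta X Y = upper (alpha * f) (beta * f) (alpha + beta) X Y.
Proof.
move=> f0 b0 co; rewrite /special /upper; congr (nat_of_bool _).
rewrite ![(_ * f * _)%N]mulnAC -addnA -mulnDl -mulnDl ltn_pmul2r // leq_pmul2r //.
rewrite addnA.
have E : (alpha * X + alpha * Y = alpha * (X + Y))%N by rewrite mulnDr.
apply/eqP/and3P => [XY|[lt_XY le_XY /dvdnP[m mE]]].
  split; try lia.
  have co' : coprime (alpha + beta) alpha by rewrite coprime_sym /coprime gcdnDl.
  rewrite -(Gauss_dvdr _ co'); apply/dvdnP; exists Y.+1; lia.
move: E; rewrite mE mulnA => E.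
have : (Y * (alpha + beta) < alpha * m * (alpha + beta))%N by lia.
have : (alpha * m * (alpha + beta) <= Y.+1 * (alpha + beta))%N by lia.
rewrite leq_pmul2r ?ltn_pmul2r ?addn_gt0 ?b0 ?orbT // => le1 le2.
have mY : (alpha * m = Y.+1)%N by lia.
by move: E; rewrite mY; lia.
Qed.

(** Only Y = 0 is compatible with Q Y < X <= N <= Q. *)
Lemma upper_flat Q n N X Y : (N <= Q)%N -> (0 < X <= N)%N ->
  upper 1 Q n X Y = flat n X Y.
Proof.
move=> NQ /andP[X0 XN]; rewrite /upper /flat; congr (nat_of_bool _).
case: Y => [|Y]; first by rewrite addn0 muln0 mul1n X0 /=; case: (_ %| _)%N; rewrite ?andbF //; lia.
by rewrite mul1n mulnS; case: ltnP => //=; nia.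
Qed.

Lemma boxsum_special alpha beta N : (0 < alpha)%N -> (0 < beta)%N -> coprime alpha beta ->
  boxsum (special alpha beta) N N N = boxsum (flat (alpha + beta)) N N N.
Proof.
move=> a0 b0 co; set n := (alpha + beta)%N.
have n_gt1 : (1 < n)%N by rewrite /n; lia.
(* Over this denominator alpha / beta has numerator alpha N!, and all critical slopes of diagrams
   with N cells are multiples of 1 / Q. *)
pose Q := (beta * N`!)%N; have Q0 : (0 < Q)%N by rewrite muln_gt0 b0 fact_gt0.
have NQ i : (0 < i <= N)%N -> (i %| Q)%N by move=> iN; apply/dvdn_mull/dvdn_fact.
have down k : boxsum (upper k.+1 Q n) N N N = boxsum (upper 1 Q n) N N N.
  elim: k => // k <-; have := @wall k.+1 Q n isT Q0 n_gt1 N.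
  rewrite /= !boxsum_pad => [->||||]; try nia.
  by apply: eq_boxsum => X Y XN; rewrite (lower_upper _ _ _ Q0 NQ XN).
transitivity (boxsum (upper (alpha * N`!) Q n) N N N).
  by apply: eq_boxsum => X Y _; apply: special_upper; rewrite ?fact_gt0.
have : (0 < alpha * N`!)%N by rewrite muln_gt0 a0 fact_gt0.
case: (alpha * _)%N => // k _; rewrite down; apply: eq_boxsum => X Y.
apply: upper_flat; case: (posnP N) => [->//|N0]; apply: dvdn_leq => //.
by rewrite NQ // N0 leqnn.
Qed.

(** * Generating functions *)

Definition letsum (f : seq bool -> {poly int}) M M' : {poly int} :=
  \sum_(w <- words (M + M') | (count_mem false w == M) && (count_mem true w == M')) f w.

Lemma letsum0 f M' : letsum f 0 M' = f (nseq M' true).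
Proof.
rewrite /letsum; elim: M' f => [|M' IHM'] f; first by rewrite /= big_cons big_nil addr0.
rewrite addnS /= big_cons /= big_cat !big_map /=.
rewrite [X in _ + X]big1 // addr0 -(IHM' (fun w => f (true :: w))) add0n.
by apply: eq_bigl => w; rewrite eqSS.
Qed.

Lemma letsumS f M M' : letsum f M.+1 M' =
  \sum_(m < M'.+1) letsum (fun w => f (nseq m true ++ false :: w)) M (M' - m).
Proof.
elim: M' f => [|M' IHM'] f.
  rewrite big_ord1 /letsum subn0 addSn /= big_cons big_cat !big_map /=.
  by rewrite [X in X + _]big1 ?add0r // => w; rewrite andbF.
rewrite big_ord_recl subn0.
have -> : letsum f M.+1 M'.+1 = letsum (fun w => f (true :: w)) M.+1 M'
            + letsum (fun w => f (false :: w)) M M'.+1.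
  by rewrite /letsum [in RHS]addSnnS [in LHS]addSn /= big_cons big_cat !big_map.
by rewrite addrC; congr (_ + _); rewrite IHM'.
Qed.

Lemma boxsum_letsum F M M' N :
  boxsum F M M' N = letsum (fun w => if area w == N then 'X^(psum F w) else 0) M M'.
Proof. by rewrite /letsum -big_mkcondr; apply: eq_bigl => w; rewrite /inbox andbA. Qed.

(** A pair with Y = 0 ends at the first letter false after its letter true. Along the run X takes
    the values 1, ..., m, and [m %/ n] of them are multiples of n. *)
Lemma psum_flat_run n m w : (0 < n)%N ->
  psum (flat n) (nseq m true ++ false :: w) = (m %/ n + psum (flat n) w)%N.
Proof.
move=> n0; have kY X Y v : (0 < Y)%N -> ksum (flat n) X Y v = 0%N.
  by elim: v X Y => [|[] v IHv] X [|Y] // _; rewrite /= IHv.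
have kE X l : ksum (flat n) X 0 (nseq l true ++ false :: w) = (n %| X + l)%N.
  elim: l X => [|l IHl] X; first by rewrite /= kY // /flat eqxx addn0 addn0.
  by rewrite /= IHl addSnnS.
elim: m => [|m IHm]; first by rewrite div0n.
by rewrite /= IHm kE add1n divnS // addnA.
Qed.

Lemma area_run m w : area (nseq m true ++ false :: w) = (m * (count_mem false w).+1 + area w)%N.
Proof.
elim: m => //= m IHm; rewrite area_cons IHm count_cat /= count_nseq /=; lia.
Qed.

(** * Power series modulo powers of t *)

Section Fps.
Local Notation R := {poly int}.
Implicit Types f g : fps R.

Definition eqm n f g := forall m, (m <= n)%N -> f m = g m.

Lemma eqmM n f f' g g' : eqm n f f' -> eqm n g g' -> eqm n (f * g) (f' * g').
Proof.
move=> ff' gg' m mn; rewrite !fps_coefM; apply: eq_bigr => -[i im] _ /=.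
by rewrite ff' ?gg' // ?(leq_trans (leq_subr _ _)) // (leq_trans _ mn).
Qed.

Lemma eqm_trans n f g h : eqm n f g -> eqm n g h -> eqm n f h.
Proof. by move=> fg gh m mn; rewrite fg ?gh. Qed.

Lemma eqm_prod1 (I : eqType) (r : seq I) (P : pred I) (F : I -> fps R) n :
  (forall i, i \in r -> P i -> eqm n (F i) 1) -> eqm n (\prod_(i <- r | P i) F i) 1.
Proof.
move=> F1; rewrite big_seq_cond; apply: (big_ind (fun f => eqm n f 1)) => //.
  by move=> f g f1 g1; rewrite -[1]mulr1; apply: eqmM.
by move=> i /andP[]; apply: F1.
Qed.

Lemma coef_tM f m : (t * f) m = if m is m'.+1 then f m' else 0.
Proof.
case: m => [|m]; rewrite fps_coefM; first by rewrite big_ord1 /= mul0r.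
rewrite !big_ord_recl /= mul0r add0r mul1r big1 ?addr0 ?subn1 // => i _.
by rewrite mul0r.
Qed.

Lemma coef_tXM k f m : (t ^+ k * f) m = if (k <= m)%N then f (m - k)%N else 0.
Proof.
elim: k m => [|k IHk] m; first by rewrite mul1r subn0.
by rewrite exprS -mulrA coef_tM; case: m => // m; rewrite IHk.
Qed.

Lemma coef_tX k m : (t ^+ k) m = (m == k)%:R.
Proof.
rewrite -[t ^+ k]mulr1 coef_tXM fps_coef1; case: leqP => [km|mk].
  by rewrite subn_eq0 eqn_leq km andbT.
by rewrite ltn_eqF.
Qed.

Lemma coef_qM f m : (q * f) m = 'X * f m.
Proof.
rewrite fps_coefM big_ord_recl subn0 big1 ?addr0 // => i _.
by rewrite /= mul0r.
Qed.

Lemma eqm_1BtX i n (a : fps R) : (n < i)%N -> eqm n (1 - a * t ^+ i) 1.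
Proof.
move=> ni m mn; rewrite fps_coefD fps_coefN mulrC coef_tXM leqNgt (leq_ltn_trans mn ni).
by rewrite subr0.
Qed.

Lemma unit_1BtX i (a : fps R) : (0 < i)%N -> 1 - a * t ^+ i \is a GRing.unit.
Proof. by move=> i0; rewrite fps_unitE (eqm_1BtX _ i0) //; apply: unitr1. Qed.

Lemma eqm_inv n f : f \is a GRing.unit -> eqm n f 1 -> eqm n (1 / f) 1.
Proof.
move=> Uf f1; apply: eqm_trans (_ : eqm n (1 / f * f) 1); last by rewrite divrK.
by rewrite -[X in eqm _ X _]mulr1; apply: eqmM => // m mn; rewrite f1.
Qed.

(** The factors of index above n are 1 up to degree n, so coefficient n is that of the partial
    product up to n. *)
Lemma fps_prod_conv (D : set nat) (d : pred nat) (F : nat -> fps R) :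
  (forall i, D i <-> (0 < i)%N && d i) ->
  (forall i n, (0 < i)%N -> d i -> (n < i)%N -> eqm n (F i) 1) ->
  exists P : fps R, has_fps_prod D F P /\
    forall n, eqm n P (\prod_(i <- iota 1 n | d i) F i).
Proof.
move=> Dd F1; pose Q n := \prod_(i <- iota 1 n | d i) F i.
have Q_le m n : (m <= n)%N -> Q n m = Q m m.
  move=> /subnKC <-; rewrite {1}/Q iotaD big_cat /=.
  rewrite -[Q m in RHS]mulr1 -/(Q m); apply: (@eqmM m) => //; apply: eqm_prod1 => i.
  by rewrite mem_iota => /andP[mi _] di; apply: F1 => //; lia.
exists (FPS (fun n => Q n n)); split=> n; last by move=> m mn; rewrite /= -(Q_le m n).
exists [fset i in iota 1 n | d i]%fset.
  by move=> i; rewrite !inE mem_iota => /andP[/andP[i0 _] di]; apply/Dd; rewrite i0.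
move=> A AD /fsubsetP nA; rewrite (bigID (fun i => i <= n)%N) /=.
rewrite -[RHS]/(Q n n) -[Q n in RHS]mulr1; apply: (@eqmM n) => // [m mn|].
  congr (fps_coef _ m); rewrite -big_filter /Q -[RHS]big_filter; apply: perm_big.
  apply: uniq_perm; rewrite ?filter_uniq ?iota_uniq ?fset_uniq // => i.
  rewrite !mem_filter mem_iota add1n ltnS.
  apply/andP/andP => [[i_n /AD/Dd/andP[-> ->]]|[di i_n]] //.
  have [i0 le_in] := andP i_n; split=> //; apply: nA.
  by rewrite !inE mem_iota add1n ltnS i_n.
apply: eqm_prod1 => i /AD/Dd/andP[i0 di]; rewrite -ltnNge => ni.
exact: F1.
Qed.

(* The series of the t^(i m) q^(m / n), with truncated quotients: columns of height
   i occurring m times. *)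
Definition runs n i : fps R :=
  FPS (fun j => if (i %| j)%N then 'X^(j %/ i %/ n) else 0).

Lemma sum_multiples (i N K : nat) (c g : nat -> R) : (0 < i)%N -> (N <= K)%N ->
  \sum_(j < N.+1) (if (i %| j)%N then c (j %/ i)%N else 0) * g (N - j)%N =
  \sum_(m < K.+1) if (m * i <= N)%N then c m * g (N - m * i)%N else 0.
Proof.
move=> i0 NK.
transitivity (\sum_(j < N.+1) \sum_(m < K.+1 | (m * i)%N == j) c m * g (N - m * i)%N).
  apply: eq_bigr => -[j jN] _ /=; case: ifP => [/dvdnP[z jE]|/negP ij].
    have zK : (z < K.+1)%N by have := leq_pmulr z i0; lia.
    rewrite (big_pred1 (Ordinal zK)) /= => [|m]; last by rewrite jE eqn_pmul2r.
    by rewrite jE mulnK.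
  rewrite mul0r big1 // => m /eqP mj; case: ij; rewrite -mj; exact: dvdn_mull.
rewrite (exchange_big_dep xpredT) //=; apply: eq_bigr => m _.
case: leqP => [miN|miN].
  by rewrite (big_pred1 (Ordinal (_ : (m * i < N.+1)%N))) // => j; rewrite /= eq_sym.
by rewrite big1 // => -[j jN] /= /eqP mj; move: miN; rewrite mj ltnNge -ltnS jN.
Qed.

(** The initial run of letters true gives the columns of height M + 1, whence an induction on the
    number of rows. By N <= M' the width of the box never limits the multiplicities. *)
Lemma boxsum_flat n M M' N : (0 < n)%N -> (N <= M')%N ->
  boxsum (flat n) M M' N = (\prod_(i <- iota 1 M) runs n i) N.
Proof.
move=> n0; elim: M M' N => [|M IHM] M' N NM'.
  rewrite boxsum_letsum letsum0 big_nil fps_coef1.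
  have c0 m : count_mem false (nseq m true) = 0%N by rewrite count_nseq.
  have -> : area (nseq M' true) = 0%N.
    by elim: {NM'} M' => // m IHm; rewrite area_cons IHm c0.
  case: N NM' => // _; rewrite [psum _ _](_ : _ = 0%N) //.
  have k0 m X : ksum (flat n) X 0 (nseq m true) = 0%N by elim: m X => //= m IHm X.
  by elim: M' => //= m ->; rewrite k0.
have -> : \prod_(i <- iota 1 M.+1) runs n i = runs n M.+1 * \prod_(i <- iota 1 M) runs n i.
  by rewrite -{1}[M.+1]addn1 iotaD big_cat big_seq1; apply: mulrC.
rewrite fps_coefM.
rewrite (@sum_multiples M.+1 N M' (fun z => 'X^(z %/ n)) (\prod_(i <- iota 1 M) runs n i)) //.
rewrite boxsum_letsum letsumS; apply: eq_bigr => -[m mM'] _ /=.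
case: leqP => [le_N|lt_N].
  rewrite -(IHM (M' - m)%N); last first.
    by have := leq_pmulr m (ltn0Sn M); lia.
  rewrite boxsum_letsum /letsum mulr_sumr; apply: eq_bigr => w /andP[/eqP wM _].
  rewrite area_run psum_flat_run // wM.
  have -> : (m * M.+1 + area w == N)%N = (area w == N - m * M.+1)%N by lia.
  by case: ifP => _; rewrite ?mulr0 // exprD.
rewrite /letsum big1 // => w /andP[/eqP wM _]; rewrite area_run wM.
by case: eqP => //; lia.
Qed.

(** Writing m = n z + r with r < n, the series is the sum of the t^(i r) divided by 1 - q t^(n
    i). *)
Lemma runsE n i : (0 < n)%N -> (0 < i)%N ->
  runs n i * (1 - q * t ^+ (n * i)) * (1 - t ^+ i) = 1 - t ^+ (n * i).
Proof.
move=> n0 i0; have -> : runs n i * (1 - q * t ^+ (n * i)) = \sum_(m < n) t ^+ i ^+ m.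
  apply: fpsP => j; have coef_sum (F : 'I_n -> fps R) : (\sum_(m < n) F m) j = \sum_(m < n) F m j.
    by apply: (big_morph (fun f : fps R => f j)).
  rewrite coef_sum mulrBr mulr1 fps_coefD fps_coefN mulrCA coef_qM [runs _ _ * _]mulrC coef_tXM.
  rewrite (eq_bigr (fun m : 'I_n => (j == i * m)%N%:R)); last first.
    by move=> m _; rewrite -exprM coef_tX.
  case: (boolP (i %| j)%N) => [/dvdnP[z ->]|ij]; last first.
    rewrite /= (negPf ij) big1 => [|m _].
      case: ifP => [le_j|_]; last by rewrite mulr0 subr0.
      by rewrite dvdn_subl ?dvdn_mull // (negPf ij) mulr0 subr0.
    by case: eqP ij => // ->; rewrite dvdn_mulr.
  rewrite /= dvdn_mull // mulnK // leq_pmul2r // -mulnBl dvdn_mull // mulnK //.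
  rewrite (eq_bigr (fun m : 'I_n => (m == z :> nat)%:R)); last first.
    by move=> m _; rewrite mulnC eqn_pmul2l // eq_sym.
  case: leqP => [nz|zn].
    rewrite -{1}(subnK nz) divnDr // divnn n0 addn1 exprS subrr big1 // => m _.
    by rewrite ltn_eqF // (leq_trans (ltn_ord m)).
  rewrite divn_small // mulr0 subr0 (bigD1 (Ordinal zn)) //= eqxx big1 ?addr0 // => m.
  by rewrite -val_eqE /= => /negPf ->.
rewrite mulrC -opprB mulNr -subrX1 opprB -exprM mulnC //.
Qed.

(** By [runsE] the numerators are the 1 - t^(n i). They cancel the denominators 1 - t^j with n
    dividing j, and those with n i > N are 1 up to degree N. *)
Lemma runs_prod n N : (0 < n)%N ->
  eqm N (\prod_(i <- iota 1 N) runs n i)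
    (\prod_(i <- iota 1 N | ~~ (n %| i)%N) (1 / (1 - t ^+ i))
     * \prod_(i <- iota 1 N) (1 / (1 - q * t ^+ (n * i)))).
Proof.
move=> n0; set P := \prod_(i <- _) runs n i; set P1 := \prod_(_ <- _ | _) _.
set P2 := \prod_(_ <- _) (1 / _).
pose U := \prod_(i <- iota 1 N) (1 - t ^+ i) : Zqt.
pose W := \prod_(i <- iota 1 N) (1 - q * t ^+ (n * i)) : Zqt.
have ut i : i \in iota 1 N -> 1 - t ^+ i \is a GRing.unit.
  by rewrite mem_iota => /andP[i0 _]; rewrite -[t ^+ i]mul1r unit_1BtX.
have uq i : i \in iota 1 N -> 1 - q * t ^+ (n * i) \is a GRing.unit.
  by rewrite mem_iota => /andP[i0 _]; rewrite unit_1BtX // muln_gt0 n0.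
have UW : W * U \is a GRing.unit.
  rewrite unitrM /W /U !big_seq; apply/andP; split;
  by apply: (big_ind (fun f => f \is a GRing.unit)) => //; [exact: unitr1 | move=> f g; rewrite unitrM => -> ->].
suff E : eqm N (P * (W * U)) (P1 * P2 * (W * U)).
  by rewrite -[P](mulrK UW) -[P1 * P2](mulrK UW); apply: eqmM.
have -> : P * (W * U) = \prod_(i <- iota 1 N) (1 - t ^+ (n * i)).
  rewrite mulrA /P /W /U -!big_split /= big_seq [RHS]big_seq; apply: eq_bigr => i.
  by rewrite mem_iota => /andP[i0 _]; apply: runsE.
have -> : P1 * P2 * (W * U) = \prod_(i <- iota 1 N | (n %| i)%N) (1 - t ^+ i).
  have P2W : P2 * W = 1.
    rewrite /P2 /W -big_split /= big_seq big1 // => i /uq Ui.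
    by rewrite mul1r mulVr.
  have -> : P1 * P2 * (W * U) = P1 * U by rewrite -mulrA (mulrA P2) P2W mul1r.
  rewrite /U (bigID (fun i => n %| i)%N) /= mulrCA -[RHS]mulr1; congr (_ * _).
  rewrite /P1 -big_split big_seq_cond big1 // => i /andP[/ut Ui _] /=.
  by rewrite mul1r mulVr.
rewrite (bigID (fun i => n * i <= N)%N) /= -[X in eqm _ _ X]mulr1.
apply: eqmM; last first.
  apply: eqm_prod1 => i _; rewrite -ltnNge => Ni.
  by rewrite -[t ^+ _]mul1r; apply: eqm_1BtX.
move=> m _; congr (fps_coef _ m).
rewrite -[LHS]big_filter -[RHS]big_filter -(big_map (muln n) xpredT (fun i => 1 - t ^+ i)).
apply: perm_big; apply: uniq_perm => [||j].
- rewrite map_inj_uniq ?filter_uniq ?iota_uniq // => x y /eqP.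
  by rewrite eqn_pmul2l // => /eqP.
- by rewrite filter_uniq ?iota_uniq.
rewrite mem_filter mem_iota add1n ltnS; apply/mapP/and3P => [[i + ->]|[/dvdnP[i ->] j0 jN]].
  rewrite mem_filter mem_iota => /and3P[iN i0 _].
  by split; rewrite ?dvdn_mulr // muln_gt0 n0.
exists i; last exact: mulnC.
rewrite mem_filter mem_iota add1n ltnS mulnC jN.
by move: j0; rewrite muln_gt0 => /andP[-> _]; rewrite (leq_trans _ jN) ?leq_pmulr.
Qed.
End Fps.

(** * Young diagrams and words *)

(* Column heights, from left to right. *)
Fixpoint cols w : seq nat :=
  match w with
  | [::] => [::]
  | true :: w' => count_mem false w' :: cols w'
  | false :: w' => cols w'
  end.

(** The inverse of [cols]: the path goes down from height [M] to [c] before a column of height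
    [c]. *)
Fixpoint word_of M (cs : seq nat) : seq bool :=
  if cs is c :: cs' then nseq (M - c) false ++ true :: word_of c cs' else nseq M false.

Lemma size_cols w : size (cols w) = count_mem true w.
Proof. by elim: w => [|[] w IHw] //=; rewrite IHw. Qed.

Lemma cols_path w : path geq (count_mem false w) (cols w).
Proof.
elim: w => [|[] w IHw] //=; first by rewrite /= leqnn.
by case: (cols w) IHw => //= c cs /andP[cw ->]; rewrite andbT; apply: leqW.
Qed.

Lemma word_ofK w : word_of (count_mem false w) (cols w) = w.
Proof.
elim: w => [|[] w IHw] //=; first by rewrite subnn /= IHw.
rewrite add1n; have := cols_path w; move: IHw; case: (cols w) => [|c cs] /= wE.
  by rewrite wE.
by move=> /andP[cw _]; rewrite subSn //= wE.
Qed.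

Lemma cols_word_of M cs : path geq M cs ->
  count_mem false (word_of M cs) = M /\ cols (word_of M cs) = cs.
Proof.
elim: cs M => [M _|c cs IHcs M] /=.
  split; first by rewrite count_nseq mul1n.
  by elim: M.
move=> /andP[cM /IHcs[cf cE]]; split; first by rewrite count_cat count_nseq /= cf mul1n add0n subnK.
by elim: (M - c)%N => //=; rewrite cf cE.
Qed.

(** Vertical steps run through the rows from the top down to row 0; before row [j] the path has
    passed exactly the columns higher than [j]. *)
Lemma ksum_cols F X Y w : ksum F X Y w =
  (\sum_(0 <= j < count_mem false w)
     F (X + count (fun c => j < c) (cols w)) (Y + (count_mem false w - j.+1)))%N.
Proof.
elim: w X Y => [|[] w IHw] X Y /=; first by rewrite big_nil.
  rewrite IHw add0n; apply: eq_big_nat => j /andP[_ jw].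
  by rewrite jw addSnnS.
rewrite add1n big_nat_recr //= subnn addn0 addnC; congr addn; last first.
  have -> : count (fun c => count_mem false w < c)%N (cols w) = 0%N; last by rewrite addn0.
  apply/eqP; rewrite -leqn0 leqNgt -has_count; apply/negP => /hasP[c].
  have /allP le_w := order_path_min (rev_trans leq_trans) (cols_path w).
  by move=> /le_w /=; rewrite leqNgt => /negP.
by rewrite IHw; apply: eq_big_nat => j /andP[_ jw]; rewrite subSn // addnS addSn.
Qed.

Lemma psum_cols F w : psum F w =
  (\sum_(0 <= i < size (cols w)) \sum_(0 <= j < nth 0 (cols w) i)
     F (count (fun c => j < c) (drop i (cols w))) (nth 0 (cols w) i - j.+1))%N.
Proof.
elim: w => [|[] w IHw]; first by rewrite /= big_nil.
  rewrite [LHS]/= [cols _]/= [size _]/= big_nat_recl //= IHw ksum_cols; congr addn.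
  by apply: eq_big_nat => j /andP[_ jw]; rewrite jw add0n.
exact: IHw.
Qed.

Lemma card_fset_count (T : choiceType) (Y : {fset T}) (P : pred T) (r : seq T) :
  uniq r -> (forall x, (x \in r) = (x \in Y)) -> #|` [fset x in Y | P x]%fset| = count P r.
Proof.
move=> Ur rY; rewrite -size_filter; apply/perm_size/uniq_perm.
- exact: fset_uniq.
- by rewrite filter_uniq.
by move=> x; rewrite mem_filter rY !inE /= andbC.
Qed.

Lemma ltn_col_len Y i j : is_young Y -> (j < col_len Y i)%N = ((i, j) \in Y).
Proof.
move=> yY; rewrite /col_len (card_fset_count _ (fset_uniq Y) (fun _ => erefl)) -size_filter.
have mem_map k j' : ((i, j') \in [seq (i, x) | x <- iota 0 k]) = (j' < k)%N.
  by rewrite mem_map ?mem_iota // => x y [].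
apply/idP/idP => [|ij].
  apply: contraLR => ij; rewrite -leqNgt.
  suff /(uniq_leq_size (filter_uniq _ (fset_uniq Y))) :
      {subset [seq s <- Y | s.1 == i] <= [seq (i, x) | x <- iota 0 j]}.
    by rewrite size_map size_iota.
  move=> [i' j']; rewrite mem_filter /= => /andP[/eqP -> ij'].
  by rewrite mem_map ltnNge; apply: contra ij => jj'; apply: yY ij' _ jj'.
suff /uniq_leq_size : {subset [seq (i, x) | x <- iota 0 j.+1] <= [seq s <- Y | s.1 == i]}.
  by rewrite size_map size_iota; apply; rewrite map_inj_uniq ?iota_uniq // => x y [].
move=> _ /mapP[j' + ->]; rewrite mem_iota /= add0n ltnS => j'j.
by rewrite mem_filter /= eqxx; apply: yY ij _ j'j.
Qed.

Lemma ltn_row_len Y i j : is_young Y -> (i < row_len Y j)%N = ((i, j) \in Y).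
Proof.
move=> yY; rewrite /row_len (card_fset_count _ (fset_uniq Y) (fun _ => erefl)) -size_filter.
have mem_map k i' : ((i', j) \in [seq (x, j) | x <- iota 0 k]) = (i' < k)%N.
  by rewrite (mem_map (f := pair^~ j)) ?mem_iota // => x y [].
apply/idP/idP => [|ij].
  apply: contraLR => ij; rewrite -leqNgt.
  suff /(uniq_leq_size (filter_uniq _ (fset_uniq Y))) :
      {subset [seq s <- Y | s.2 == j] <= [seq (x, j) | x <- iota 0 i]}.
    by rewrite size_map size_iota.
  move=> [i' j']; rewrite mem_filter /= => /andP[/eqP -> ij'].
  by rewrite mem_map ltnNge; apply: contra ij => ii'; apply: yY ij' ii' _.
suff /uniq_leq_size : {subset [seq (x, j) | x <- iota 0 i.+1] <= [seq s <- Y | s.2 == j]}.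
  by rewrite size_map size_iota; apply; rewrite map_inj_uniq ?iota_uniq // => x y [].
move=> _ /mapP[i' + ->]; rewrite mem_iota /= add0n ltnS => i'i.
by rewrite mem_filter /= eqxx; apply: yY ij i'i _.
Qed.

(** * Diagrams given by their column heights *)

Definition boxes (cs : seq nat) : seq (nat * nat) :=
  [seq (i, j) | i <- index_iota 0 (size cs), j <- index_iota 0 (nth 0%N cs i)].

Definition diagram cs : {fset nat * nat} := [fset s in boxes cs]%fset.

Lemma mem_boxes cs i j : ((i, j) \in boxes cs) = (j < nth 0 cs i)%N.
Proof.
apply/allpairsPdep/idP => [[i' [j' [+ + [-> ->]]]]|ij].
  by rewrite !mem_index_iota.
exists i, j; rewrite !mem_index_iota /= ij; split=> //.
by rewrite ltnNge; apply/negP => /(nth_default 0%N) i0; rewrite i0 in ij.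
Qed.

Lemma mem_diagram cs i j : ((i, j) \in diagram cs) = (j < nth 0 cs i)%N.
Proof. by rewrite in_fset mem_boxes. Qed.

Lemma boxes_uniq cs : uniq (boxes cs).
Proof.
apply: allpairs_uniq_dep => [|i _|]; rewrite ?iota_uniq //.
by move=> [i j] [i' j'] _ _ /= [-> ->].
Qed.

Lemma sorted_nth cs i j : sorted geq cs -> (i <= j)%N -> (nth 0 cs j <= nth 0 cs i)%N.
Proof.
move=> srt ij; have [js|sj] := ltnP j (size cs); last by rewrite nth_default.
apply: (sorted_leq_nth (rev_trans leq_trans) leqnn 0%N srt) => //.
by rewrite inE (leq_ltn_trans ij).
Qed.

Lemma diagram_young cs : sorted geq cs -> is_young (diagram cs).
Proof.
move=> srt i j i' j'; rewrite !mem_diagram => ij ii jj.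
exact: leq_ltn_trans jj (leq_trans ij (sorted_nth srt ii)).
Qed.

Lemma ltn_eq m n : (forall k, (k < m)%N = (k < n)%N) -> m = n.
Proof. by move=> mn; apply/eqP; rewrite eqn_leq leqNgt mn ltnn leqNgt -mn ltnn. Qed.

Lemma col_len_diagram cs i : sorted geq cs -> col_len (diagram cs) i = nth 0%N cs i.
Proof.
by move=> srt; apply: ltn_eq => j; rewrite ltn_col_len ?mem_diagram //; apply: diagram_young.
Qed.

(** This is conjugation of partitions: in a decreasing sequence the entries above [j] come first. *)
Lemma ltn_count_sorted cs j k : sorted geq cs ->
  (k < count (fun c => j < c) cs)%N = (j < nth 0 cs k)%N.
Proof.
elim: cs k => [|c cs IHcs] k srt /=; first by rewrite nth_nil !ltn0.
have {}IHcs := IHcs _ (path_sorted srt).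
have /allP le_c := order_path_min (rev_trans leq_trans) srt.
have [jc|cj] := ltnP j c; first by case: k => [|k] /=; rewrite ?jc ?add1n ?ltnS ?IHcs.
have -> : count (fun c => j < c)%N cs = 0%N.
  apply/eqP; rewrite -leqn0 leqNgt -has_count; apply/negP => /hasP[d /le_c /= dc].
  by rewrite ltnNge (leq_trans dc cj).
rewrite ltn0; case: k => [|k] /=; apply/esym/negbTE; rewrite -leqNgt //.
have [ks|sk] := ltnP k (size cs); last by rewrite nth_default.
by apply: leq_trans cj; apply: le_c; apply: mem_nth.
Qed.

Lemma row_len_diagram cs i j : sorted geq cs -> (j < nth 0 cs i)%N ->
  row_len (diagram cs) j = (i + count (fun c => j < c) (drop i cs))%N.
Proof.
move=> srt ij; have yY := diagram_young srt.
have -> : row_len (diagram cs) j = count (fun c => j < c)%N cs.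
  by apply: ltn_eq => k; rewrite ltn_row_len // mem_diagram ltn_count_sorted.
rewrite -{1}(cat_take_drop i cs) count_cat; congr addn.
have i_cs : (i < size cs)%N.
  by rewrite ltnNge; apply/negP => /(nth_default 0%N) i0; rewrite i0 in ij.
rewrite -{2}(size_takel (ltnW i_cs)); apply/eqP; rewrite -all_count; apply/(all_nthP 0%N) => k.
rewrite size_takel ?(ltnW i_cs) // => ki; rewrite nth_take //=.
exact: leq_trans ij (sorted_nth srt (ltnW ki)).
Qed.

Lemma card_diagram w : #|` diagram (cols w)| = area w.
Proof.
have <- : [fset x in diagram (cols w) | xpredT x]%fset = diagram (cols w).
  by apply/fsetP => x; rewrite !inE /= andbT.
rewrite (@card_fset_count _ _ _ (boxes (cols w))) ?boxes_uniq //; last first.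
  by move=> x; rewrite in_fset.
rewrite -sum1_count /area psum_cols big_allpairs_dep.
by apply: eq_bigr.
Qed.

Lemma nb_special_diagram alpha beta w : nb_special (diagram (cols w)) alpha beta
  = psum (special alpha beta) w.
Proof.
have srt : sorted geq (cols w) by apply: path_sorted (cols_path w).
rewrite /nb_special (@card_fset_count _ _ _ (boxes (cols w))) ?boxes_uniq //; last first.
  by move=> x; rewrite in_fset.
rewrite -sum1_count big_mkcond big_allpairs_dep psum_cols /=.
apply: eq_bigr => i _; apply: eq_big_nat => j /andP[_ ij].
rewrite /leg /arm /special /= col_len_diagram // (row_len_diagram srt ij).
(* Column i itself is counted, so X = l + 1 is positive. *)
have : (0 < count (fun c => j < c)%N (drop i (cols w)))%N.
  rewrite (drop_nth 0%N) /= ?ij // ltnNge; apply/negP => /(nth_default 0%N) i0.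
  by rewrite i0 in ij.
move: (count _ _) (nth _ _ _) ij => X c jc X0.
rewrite [RHS](_ : _ = (if (alpha * X == beta * (c - j.+1) + alpha + beta)%N then 1 else 0)%N); last by case: eqP.
congr (if _ then _ else _).
have -> : (i + X)%:Z - i%:Z - 1 = X.-1%:Z by lia.
have -> : c%:Z - j%:Z - 1 + 1 = (c - j.+1).+1%:Z by lia.
by rewrite -!PoszM eqz_nat; case: X X0 => // X _; rewrite /= !mulnS; lia.
Qed.

Lemma young_diagram Y : is_young Y -> let N := #|` Y| in
  exists2 w, w \in [seq w <- words (N + N) | inbox N N N w] & Y = diagram (cols w).
Proof.
(* A diagram with N cells fits into the N by N box; trailing zero heights are kept so that the path
   has exactly N horizontal steps. *)
move=> yY N; pose cs := mkseq (col_len Y) N.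
have iN i j : (i, j) \in Y -> (i < N)%N.
  rewrite -ltn_row_len // => /leq_trans; apply.
  by apply: fsubset_leq_card; apply/fsubsetP => x; rewrite !inE => /andP[].
have cN i : (col_len Y i <= N)%N.
  by apply: fsubset_leq_card; apply/fsubsetP => x; rewrite !inE => /andP[].
have cs_path : path geq N cs.
  rewrite (path_sortedE (rev_trans leq_trans)); apply/andP; split.
    by apply/allP => _ /mapP[i _ ->]; apply: cN.
  apply: (homo_sorted (e := leq)); last exact: iota_sorted.
  move=> i i' ii' /=; rewrite leqNgt; apply/negP => lt_c.
  have := yY _ _ i (col_len Y i) (etrans (esym (ltn_col_len _ _ yY)) lt_c) ii' (leqnn _).
  by rewrite -ltn_col_len // ltnn.
have [cf cE] := cols_word_of cs_path.
have YE : Y = diagram (cols (word_of N cs)).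
  apply/fsetP => -[i j]; rewrite mem_diagram cE.
  have [iN'|Ni] := ltnP i N; first by rewrite nth_mkseq // ltn_col_len.
  rewrite nth_default ?size_mkseq // ltn0; apply/negP => /iN.
  by rewrite ltnNge Ni.
exists (word_of N cs) => //.
have ct : count_mem true (word_of N cs) = N by rewrite -size_cols cE size_mkseq.
rewrite mem_filter mem_words /inbox cf ct !eqxx /= -card_diagram -YE eqxx /=.
by rewrite -count_bool cf ct.
Qed.

(** * The coefficient of t^N in both sides *)

Lemma coef_qXM k (f : Zqt) m : (q ^+ k * f) m = 'X^k * f m.
Proof.
by elim: k => [|k IHk]; rewrite ?expr0 ?mul1r // !exprS -!mulrA coef_qM IHk.
Qed.

Theorem theorem1p2 (alpha beta : nat)
    (alpha_gt0 : (0 < alpha)%N) (beta_gt0 : (0 < beta)%N)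
    (co_alpha_beta : coprime alpha beta) :
  exists S P1 P2 : Zqt,
    [/\ has_fps_sum young
          (fun Y : {fset nat * nat} => q ^+ nb_special Y alpha beta * t ^+ #|` Y|) S,
        has_fps_prod [set i : nat | (1 <= i)%N /\ ~~ (alpha + beta %| i)%N]%classic
          (fun i : nat => 1 / (1 - t ^+ i)) P1,
        has_fps_prod [set i : nat | (1 <= i)%N]%classic
          (fun i : nat => 1 / (1 - q * t ^+ ((alpha + beta) * i)%N)) P2
      & S = P1 * P2].
Proof.
set n := (alpha + beta)%N; have n0 : (0 < n)%N by rewrite addn_gt0 alpha_gt0.
have [P1 [prodP1 P1E]] : exists P : Zqt,
    has_fps_prod [set i : nat | (1 <= i)%N /\ ~~ (n %| i)%N]%classic
      (fun i => 1 / (1 - t ^+ i)) P /\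
    forall N, eqm N P (\prod_(i <- iota 1 N | ~~ (n %| i)%N) (1 / (1 - t ^+ i))).
  apply: fps_prod_conv => [i|i N i0 _ Ni]; first by split=> [[-> ->]|/andP].
  rewrite -[t ^+ i]mul1r; apply: eqm_inv; [exact: unit_1BtX | exact: eqm_1BtX].
have [P2 [prodP2 P2E]] : exists P : Zqt,
    has_fps_prod [set i : nat | (1 <= i)%N]%classic
      (fun i => 1 / (1 - q * t ^+ (n * i)%N)) P /\
    forall N, eqm N P (\prod_(i <- iota 1 N | xpredT i) (1 / (1 - q * t ^+ (n * i)))).
  apply: fps_prod_conv => [i|i N i0 _ Ni]; first by rewrite andbT.
  have Nni : (N < n * i)%N by apply: leq_trans Ni (leq_pmull _ n0).
  by apply: eqm_inv; [apply: unit_1BtX; apply: leq_ltn_trans Nni | apply: eqm_1BtX].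
exists (P1 * P2), P1, P2; split=> // N.
pose ws := [seq w <- words (N + N) | inbox N N N w].
have srt w : sorted geq (cols w) by apply: path_sorted (cols_path w).
have diag_inj : {in ws &, injective (fun w => diagram (cols w))}.
  move=> w w'; rewrite !mem_filter => /andP[/and3P[/eqP cf /eqP ct _] _].
  move=> /andP[/and3P[/eqP cf' /eqP ct' _] _] E.
  rewrite -[w]word_ofK -[w']word_ofK cf cf'; congr word_of.
  apply: (@eq_from_nth _ 0%N) => [|i _]; first by rewrite !size_cols ct ct'.
  by rewrite -!col_len_diagram ?E.
(* All diagrams with N cells: any further diagram contributes nothing to the coefficient of t^N. *)
exists [fset Y in [seq diagram (cols w) | w <- ws]]%fset.
  by move=> Y; rewrite !inE => /mapP[w _ ->]; apply: diagram_young.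
move=> A A_young /fsubsetP sub_A.
rewrite (big_morph (fun f : Zqt => f N) (id1 := 0) (op1 := +%R)) //.
transitivity (\sum_(Y <- A | #|` Y| == N) 'X^(nb_special Y alpha beta) : {poly int}).
  rewrite [RHS]big_mkcond; apply: eq_bigr => Y _.
  by rewrite coef_qXM coef_tX eq_sym; case: eqP; rewrite ?mulr1 ?mulr0.
have -> : \sum_(Y <- A | #|` Y| == N) 'X^(nb_special Y alpha beta)
          = \sum_(w <- ws) 'X^(nb_special (diagram (cols w)) alpha beta) :> {poly int}.
  rewrite -big_filter -(big_map (fun w => diagram (cols w)) xpredT
    (fun Y => 'X^(nb_special Y alpha beta))).
  apply: perm_big; apply: uniq_perm.
  - by rewrite filter_uniq ?fset_uniq.
  - by rewrite map_inj_in_uniq ?filter_uniq ?words_uniq.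
  move=> Y; rewrite mem_filter; apply/andP/idP => [[/eqP YN /A_young yY]|YA].
    by have [w] := young_diagram yY; rewrite YN => w_ws ->; apply: (map_f (fun w => diagram (cols w))).
  split; last by apply: sub_A; rewrite !inE.
  have [w] := mapP YA; rewrite mem_filter => /andP[/and3P[_ _ aw] _] ->.
  by rewrite card_diagram.
transitivity (boxsum (special alpha beta) N N N).
  by rewrite /ws big_filter; apply: eq_bigr => w _; rewrite nb_special_diagram.
(* Slope alpha / beta is moved to slope 0, where the count factors over the column heights. *)
rewrite boxsum_special // boxsum_flat // (runs_prod n0 (leqnn N)).
by symmetry; apply: (@eqmM N).
Qed.
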